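(* Let $(\mathscr{A}_1,V_1)$ and $(\mathscr{A}_2,V_2)$ be central hyperplane arrangements over $\mathbb{K}$ with $\ell_1=\dim V_1>0$ and $\ell_2=\dim V_2>0$, and let $m\geq 1$. The product arrangement $(\mathscr{A}_1\times\mathscr{A}_2,V_1\oplus V_2)$ is $m$-free if and only if both $(\mathscr{A}_1,V_1)$ and $(\mathscr{A}_2,V_2)$ are $i$-free for all integers $i$ with $1\leq i\leq m$. Moreover, in that case, if $\exp_i(\mathscr{A}_1)=\{d_j^{(i)}\mid 1\leq j\leq s_i(\ell_1)\}$ and $\exp_{m-i}(\mathscr{A}_2)=\{e_k^{(m-i)}\mid 1\leq k\leq s_{m-i}(\ell_2)\}$ for $0\leq i\leq m$, then $$\exp_m(\mathscr{A}_1\times\mathscr{A}_2)=\bigcup_{i=0}^{m}\{d_j^{(i)}+e_k^{(m-i)}\mid 1\leq j\leq s_i(\ell_1),\ 1\leq k\leq s_{m-i}(\ell_2)\}$$ (union of multisets).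
   Context: $\mathbb{K}$ is a field of characteristic zero. For an $\ell$-dimensional $\mathbb{K}$-vector space $V$, let $S=\mathrm{Sym}(V^* )=\mathbb{K}[x_1,\dots,x_\ell]$. A (central) arrangement $\mathscr{A}$ in $V$ is a finite set of linear hyperplanes; for $H\in\mathscr{A}$ choose $\alpha_H\in V^*$ with kernel $H$, and set $Q=Q(\mathscr{A})=\prod_{H\in\mathscr{A}}\alpha_H$. Regard $x_i$ (multiplication) and $\partial_i=\partial/\partial x_i$ as elements of $\mathrm{End}_{\mathbb{K}}(S)$, which is an $S$-module by left multiplication. For $m\geq1$ let $D^{(m)}(S)=\bigoplus_{|\bm a|=m}S\partial^{\bm a}$ (multi-index notation, $\bm a\in\mathbb{N}^\ell$), and $D^{(0)}(S)=S$. Define $D^{(m)}(\mathscr{A})=\{\theta\in D^{(m)}(S)\mid \theta(QS)\subseteq QS\}$; $\mathscr{A}$ is called $m$-free if $D^{(m)}(\mathscr{A})$ is a free $S$-module (its rank is then $s_m(\ell)=\binom{\ell+m-1}{m}$). An operator $\sum f_{\bm a}\partial^{\bm a}$ is homogeneous of degree $i$ if each $f_{\bm a}$ is $0$ or homogeneous of degree $i$; $D^{(m)}(\mathscr{A})$ is graded. For $m\geq1$ and $\mathscr{A}$ $m$-free with homogeneous basis $\theta_1,\dots,\theta_s$, the $m$-exponents are the multiset $\exp_m(\mathscr{A})=\{\deg\theta_1,\dots,\deg\theta_s\}$ (independent of the basis); by convention $\exp_0(\mathscr{A})=\{0\}$ for every $\mathscr{A}$. The product of arrangements $(\mathscr{A}_1,V_1)$,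 $(\mathscr{A}_2,V_2)$ is the arrangement $\mathscr{A}_1\times\mathscr{A}_2=\{H\oplus V_2\mid H\in\mathscr{A}_1\}\cup\{V_1\oplus H\mid H\in\mathscr{A}_2\}$ in $V_1\oplus V_2$; its defining polynomial is $Q(\mathscr{A}_1)Q(\mathscr{A}_2)$. *)

(* Defs.v *)
From HB Require Import structures.
From mathcomp Require Import all_boot all_order all_algebra.
From mathcomp Require Import finmap.
From mathcomp.multinomials Require Import mpoly.

Set Implicit Arguments.
Unset Strict Implicit.
Unset Printing Implicit Defensive.

Import GRing.Theory.

Local Open Scope ring_scope.

Notation "p ^`M [ a ]" := (mderivm a p) : ring_scope.

Section Arrangements.
Variables (K : fieldType) (V : vectType K).

Definition arrangement (A : {fset {vspace V}}) : Prop :=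
  forall H, H \in A -> (\dim H).+1 = \dim {:V}.

Lemma hyperplane_form (H : {vspace V}) : exists a : 'Hom(V, K^o),
  ((\dim H).+1 == \dim {:V}) ==> (lker a == H).
Proof.
have [dimH|_] := eqVneq (\dim H).+1 (\dim {:V}); last by exists 0.
set w := vpick (H^C)%VS.
have dimC : \dim (H^C)%VS = 1%N by rewrite dimv_compl -dimH subSnn.
have wC : w \in (H^C)%VS by apply: memv_pick.
have w0 : w != 0 by rewrite vpick0 -dimv_eq0 dimC.
have capC : (H^C :&: H = 0)%VS by rewrite capvC capv_compl.
have addC : (H^C + H = {:V})%VS by rewrite addvC addv_complf.
have wE : <[w]>%VS = (H^C)%VS.
  by apply/eqP; rewrite eqEdim -memvE wC dimC dim_vline w0.
pose f (u : V) : K^o := coord [tuple w] 0 (daddv_pi (H^C)%VS H u).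
have flin : linear f by move=> k x y; rewrite /f !linearP.
pose fL := HB.pack_for {linear V -> K^o} f
  (GRing.isLinear.Build _ _ _ _ f flin).
exists (linfun fL); rewrite implyTb; apply/eqP/vspaceP => u.
rewrite memv_ker lfunE /= /f.
have uE : daddv_pi (H^C)%VS H u + daddv_pi H (H^C)%VS u = u.
  by apply: daddv_pi_add; rewrite // addC memvf.
have pC : daddv_pi (H^C)%VS H u \in <[w]>%VS by rewrite wE memv_pi.
apply/eqP/idP => [f0|uH].
  have : daddv_pi (H^C)%VS H u = 0.
    have pC' : daddv_pi (H^C)%VS H u \in <<[tuple w]>>%VS by rewrite span_seq1.
    by rewrite (coord_span pC') big_ord1 f0 scale0r.
  by move=> p0; rewrite -uE p0 add0r memv_pi.
suff -> : daddv_pi (H^C)%VS H u = 0 by rewrite linear0.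
apply/eqP; rewrite -memv0 -capC memv_cap memv_pi /=.
have -> : daddv_pi (H^C)%VS H u = u - daddv_pi H (H^C)%VS u.
  by rewrite -{2}uE addrK.
by rewrite memvB // memv_pi.
Qed.

Definition alpha (H : {vspace V}) : 'Hom(V, K^o) := xchoose (hyperplane_form H).

Lemma lker_alpha (H : {vspace V}) :
  (\dim H).+1 = \dim {:V} -> lker (alpha H) = H.
Proof.
by move=> /eqP dimH; apply/eqP/(implyP (xchooseP (hyperplane_form H))).
Qed.

(* A basis v of V identifies Sym(V^* ) with K[x_0, ..., x_(l-1)], where the
   x_i are the coordinates dual to v; a linear form a is then the polynomial
   \sum_i a(v_i) x_i. *)
Definition form_poly (l : nat) (v : l.-tuple V) (a : 'Hom(V, K^o)) :
    {mpoly K[l]} :=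
  \sum_(i < l) (a (tnth v i) : K) *: 'X_i.

Definition defpoly (l : nat) (v : l.-tuple V) (A : {fset {vspace V}}) :
    {mpoly K[l]} :=
  \prod_(H <- A) form_poly v (alpha H).

End Arrangements.

Section Operators.
Variables (K : fieldType) (l m : nat).
Local Notation S := {mpoly K[l]}.

(* \sum_(|a| = m) f_a d^a; the multi-indices of degree < m.+1 form a finType.
   Operators are compared extensionally (=1), as elements of End_K(S). *)
Definition diffop (f : 'X_{1..l} -> S) : S -> S := fun p =>
  \sum_(a : 'X_{1..l < m.+1} | mdeg a == m) f a * p^`M[a].

Definition inDS (theta : S -> S) : Prop :=
  exists f : 'X_{1..l} -> S, theta =1 diffop f.

Definition homogeneous_op (d : nat) (theta : S -> S) : Prop :=
  exists f : 'X_{1..l} -> S,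
    (forall a, mdeg a = m -> f a \is d.-homog) /\ theta =1 diffop f.

End Operators.

Section LogOperators.
Variables (K : fieldType) (V : vectType K) (l : nat) (v : l.-tuple V) (m : nat).
Variable A : {fset {vspace V}}.
Local Notation S := {mpoly K[l]}.
Local Notation Q := (defpoly v A).

Definition inDA (theta : S -> S) : Prop :=
  inDS m theta /\ forall p : S, exists q : S, theta (Q * p) = Q * q.

Definition is_basisDA (n : nat) (theta : 'I_n -> S -> S) : Prop :=
  [/\ forall j, inDA (theta j),
      forall eta, inDA eta ->
        exists c : 'I_n -> S, eta =1 (fun p => \sum_(j < n) c j * theta j p)
    & forall c : 'I_n -> S,
        (forall p, \sum_(j < n) c j * theta j p = 0) -> forall j, c j = 0].

(* The rank is left free: as D^(m)(A) lies between Q D^(m)(S) and D^(m)(S),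
   any basis is finite, with 'C(l + m - 1, m) elements. *)
Definition mfree : Prop :=
  exists (n : nat) (theta : 'I_n -> S -> S), is_basisDA theta.

(* d lists, in some order, the m-exponents of A. *)
Definition is_exp (d : seq nat) : Prop :=
  if m == 0%N then d = [:: 0%N] else
  exists theta : 'I_(size d) -> S -> S,
    is_basisDA theta /\
    forall j : 'I_(size d), homogeneous_op m (nth 0%N d j) (theta j).

End LogOperators.

Section Product.
Variables (K : fieldType) (V1 V2 : vectType K).

Definition dsum (U1 : {vspace V1}) (U2 : {vspace V2}) : {vspace V1 * V2} :=
  (linfun (@fst V1 V2) @^-1: U1 :&: linfun (@snd V1 V2) @^-1: U2)%VS.

Definition prod_arr (A1 : {fset {vspace V1}}) (A2 : {fset {vspace V2}}) :
    {fset {vspace V1 * V2}} :=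
  ([fset dsum H {:V2} | H in A1] `|` [fset dsum {:V1} H | H in A2])%fset.

Definition prod_basis (l1 l2 : nat) (v1 : l1.-tuple V1) (v2 : l2.-tuple V2) :
    (l1 + l2).-tuple (V1 * V2) :=
  [tuple of [seq (u, 0) | u <- v1] ++ [seq (0, w) | w <- v2]].

End Product.

(* Main.v *)
Require Import Defs.
From Stdlib Require Import Classical_Prop.
From HB Require Import structures.
From mathcomp Require Import all_boot all_order all_algebra.
From mathcomp Require Import perm finmap zify.
From mathcomp.multinomials Require Import mpoly.

(* In the divided power basis d^a / a!, an operator of order m with
   coefficients g_a preserves QS if and only if all its iterated commutators
   with the variables map Q into QS, which is a finite system of linear
   conditions on (g_a).  For Q = Q1(x) Q2(y), downward induction on the order in
   y, together with the coprimality of Q1 and Q2, shows that these conditions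
   say that every block of bidegree (i, m - i) lies both in D^i(A1) (x) S2 and
   in S1 (x) D^(m-i)(A2), up to extension of scalars.

   If all factors are free, the tensor products of their bases form a
   homogeneous basis of the product.

   Conversely, fix an operator of A2 of order m - i involving a monomial y^e of
   minimal degree.  Tensoring with it and extracting the coefficient of y^e
   make D^i(A1) a direct summand of a free module over S1.  A graded module of
   this kind is free: in a minimal homogeneous system of generators the
   idempotent matrix of the projection is the identity modulo the maximal
   ideal, so it has determinant 1 and is the identity.

   The exponents do not depend on the basis because a transition matrix is
   invertible modulo the maximal ideal, where it only links equal degrees. *)

Set Implicit Arguments.
Unset Strict Implicit.
Unset Printing Implicit Defensive.

Import GRing.Theory.

Local Open Scope ring_scope.

(** * Graded modules over a polynomial ring *)

Section HomogeneousPart.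
Variables (K : fieldType) (l : nat).
Implicit Types p q : {mpoly K[l]}.

Lemma pihomogM_homog d e p q : q \is e.-homog ->
  pihomog mdeg d (p * q) =
    if (e <= d)%N then pihomog mdeg (d - e) p * q else 0.
Proof.
move=> hq; have [k lepk] : exists k, (msize p <= k)%N by exists (msize p).
(* The bound exceeds [d] so that the degree [d - e] is among the indices of the partition even when
   it is beyond the size of [p]. *)
have ltsum : (msize p <= maxn k d.+1)%N by rewrite leq_max lepk.
rewrite {1}(pihomog_partitionE ltsum) mulr_suml linear_sum /=.
have piM (i : nat) : pihomog mdeg d (pihomog mdeg i p * q) =
    if (i + e == d)%N then pihomog mdeg i p * q else 0.
  have h := dhomogM (pihomogP mdeg i p) hq.
  by case: eqP => [<-|/eqP ne]; [rewrite pihomog_dE | rewrite (pihomog_ne0 ne)].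
rewrite (eq_bigr _ (fun i _ => piM (i : 'I_(maxn k d.+1)))) -big_mkcond /=.
have [le|lt] := leqP e d; last first.
  by rewrite big_pred0 // => i; apply/eqP; lia.
have ltd : (d - e < maxn k d.+1)%N by lia.
rewrite (big_pred1 (Ordinal ltd)) // => i /=.
by rewrite -[i == _]val_eqE /=; apply/eqP/eqP; lia.
Qed.

Lemma pihomogM_homogl d e p q : p \is e.-homog ->
  pihomog mdeg d (p * q) =
    if (e <= d)%N then p * pihomog mdeg (d - e) q else 0.
Proof. by move=> hp; rewrite mulrC (pihomogM_homog _ _ hp) mulrC. Qed.

Lemma mcoeff_pihomog d p a :
  (pihomog mdeg d p)@_a = if mdeg a == d then p@_a else 0.
Proof.
rewrite (pihomogwE _ _ (leqnn (msize p))) raddf_sum /=.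
rewrite (eq_bigr (fun i : 'X_{1..l < msize p} => p@_i * (i == a :> 'X_{1..l})%:R));
  last by move=> i _; rewrite mcoeffZ mcoeffX.
have [da|da] := eqVneq (mdeg a) d; last first.
  rewrite big1 // => i /eqP di; case: eqP => [eq|]; last by rewrite mulr0.
  by rewrite -eq di eqxx in da.
have [lt|ge] := ltnP (mdeg a) (msize p).
  rewrite (bigD1 (BMultinom lt)) /=; last by rewrite da.
  rewrite eqxx mulr1 big1 ?addr0 // => i /andP[_ ne].
  by move: ne; rewrite bmeqP /= => /negbTE ->; rewrite mulr0.
rewrite (memN_msupp_eq0 (msize_mdeg_ge ge)) big1 // => i _.
case: eqP => [eq|]; last by rewrite mulr0.
by rewrite -eq leqNgt bmdeg in ge.
Qed.

Lemma pihomog0E p : pihomog mdeg 0 p = (p@_0%MM)%:MP.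
Proof.
apply/mpolyP=> a; rewrite mcoeff_pihomog mcoeffC mdeg_eq0.
by case: eqP => [->|_]; rewrite ?mulr1 ?mulr0.
Qed.

Lemma mcoeff0_pihomog d p : (pihomog mdeg d p)@_0%MM = (d == 0%N)%:R * p@_0%MM.
Proof.
by rewrite mcoeff_pihomog mdeg0 eq_sym; case: eqP; rewrite ?mul1r ?mul0r.
Qed.

End HomogeneousPart.

Section GradedModules.
Variables (K : fieldType) (l r : nat).
Local Notation S := {mpoly K[l]}.
Local Notation pi := (pihomog mdeg).

Definition is_free n (v : 'M[S]_(n, r)) : Prop :=
  forall c : 'rV_n, c *m v = 0 -> c = 0.

Lemma is_freeM n (v : 'M[S]_(n, r)) k (C : 'M_(k, n)) :
  is_free v -> C *m v = 0 -> C = 0.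
Proof.
move=> fv Cv; apply/row_matrixP => i; rewrite row0; apply: fv.
by rewrite -row_mul Cv row0.
Qed.

(** The rows being homogeneous, a graded part of a combination involves only one graded part of each
    coefficient. Relations between the rows can thus be made homogeneous. *)
Lemma eq_homog_row n (v : 'M[S]_(n, r)) (dg : 'I_n -> nat) (d : nat)
    (c : 'rV[S]_n) :
  (forall i k, v i k \is (dg i).-homog) ->
  map_mx (pi d) (c *m v) =
    (\row_i if (dg i <= d)%N then pi (d - dg i)%N (c 0 i) else 0) *m v.
Proof.
move=> hv; apply/matrixP=> i k; rewrite !mxE linear_sum /=.
apply: eq_bigr => j _; rewrite !mxE ord1 (pihomogM_homog _ _ (hv j k)).
by case: ifP; rewrite ?mul0r.
Qed.

(* The transition matrix between two homogeneous bases is invertible, and an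
   entry of it with nonzero constant term links basis elements of the same
   degree. *)
Lemma homog_basis_degrees n n' (v : 'M[S]_(n, r)) (v' : 'M[S]_(n', r))
    (dg : 'I_n -> nat) (dg' : 'I_n' -> nat) C C' :
  is_free v -> is_free v' -> v = C *m v' -> v' = C' *m v ->
  (forall i k, v i k \is (dg i).-homog) ->
  (forall i k, v' i k \is (dg' i).-homog) ->
  perm_eq [seq dg i | i <- enum 'I_n] [seq dg' i | i <- enum 'I_n'].
Proof.
move=> fv fv' vE v'E hv hv'.
have CC' : C *m C' = 1%:M.
  apply/eqP; rewrite -subr_eq0; apply/eqP; apply: is_freeM fv _.
  by rewrite mulmxBl mul1mx -mulmxA -v'E -vE subrr.
have C'C : C' *m C = 1%:M.
  apply/eqP; rewrite -subr_eq0; apply/eqP; apply: is_freeM fv' _.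
  by rewrite mulmxBl mul1mx -mulmxA -vE -v'E subrr.
have nn' : n = n'.
  by apply/eqP; rewrite eqn_leq (mulmx1_min CC') (mulmx1_min C'C).
case: n' / nn' in v' dg' C C' fv' vE v'E hv' CC' C'C *.
(* Comparing the parts of degree [dg i] in row [i], freeness makes [C i k] homogeneous of degree
   [dg i - dg' k], or zero if this is negative; a nonzero constant term then forces equal
   degrees. *)
have degE i k : (C i k)@_0%MM != 0 -> dg i = dg' k.
  move=> nz; have := eq_homog_row (dg i) (row i C) hv'.
  rewrite -row_mul -vE.
  have -> : map_mx (pi (dg i)) (row i v) = row i C *m v'.
    rewrite -row_mul -vE; apply/matrixP=> a b; rewrite !mxE.
    by rewrite pihomog_dE.
  move/eqP; rewrite -subr_eq0 -mulmxBl => /eqP/fv'/matrixP/(_ 0 k)/eqP.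
  rewrite !mxE subr_eq0 => /eqP CE; move: nz; rewrite CE.
  case: leqP => [le|_]; last by rewrite mcoeff0 eqxx.
  rewrite mcoeff0_pihomog; case: (_ =P 0%N) => [|_]; last by rewrite mul0r eqxx.
  by lia.
have : \det (map_mx (mcoeff 0%MM) C) != 0.
  rewrite det_map_mx; apply/eqP => d0.
  have : \det (C *m C') = 1 by rewrite CC' det1.
  rewrite det_mulmx => /(congr1 (mcoeff 0%MM)).
  by rewrite rmorphM /= d0 mul0r mcoeff1 eqxx => /esym/eqP; rewrite oner_eq0.
rewrite /determinant => nz.
(* A nonzero determinant has a nonzero term in its expansion, and the permutation of this term
   matches the two lists of degrees. *)
have [s hs] : exists s : 'S_n, \prod_i (map_mx (mcoeff 0%MM) C) i (s i) != 0.
  apply/existsP; apply: contraR nz; rewrite negb_exists => /forallP h.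
  by rewrite big1 // => s _; have /negPn/eqP -> := h s; rewrite mulr0.
have {}hs i : dg i = dg' (s i).
  by apply: degE; move/prodf_neq0: hs => /(_ i isT); rewrite mxE.
rewrite (eq_map hs) (map_comp dg' s); apply/perm_map/uniq_perm.
- by rewrite map_inj_uniq ?enum_uniq //; apply: perm_inj.
- exact: enum_uniq.
by move=> i; rewrite mem_enum -(permKV s i) map_f ?mem_enum.
Qed.

Variable N : 'rV[S]_r -> Prop.

Definition generates n (v : 'M[S]_(n, r)) : Prop :=
  (forall i, N (row i v)) /\ forall u, N u -> exists c : 'rV_n, u = c *m v.

Lemma generatesM n (v : 'M[S]_(n, r)) k (w : 'M_(k, r)) :
  generates v -> (forall i, N (row i w)) -> exists C : 'M_(k, n), w = C *m v.
Proof.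
move=> [_ gv] Nw; have [C hC] := fin_all_exists (fun i => gv _ (Nw i)).
exists (\matrix_i C i); apply/row_matrixP => i.
by rewrite row_mul rowK hC.
Qed.

(* [E] presents the module generated by the rows of [v] as a direct summand of
   the free module: it is a projection along the relations between them. *)
Definition splits n (v : 'M[S]_(n, r)) (E : 'M_n) : Prop :=
  E *m v = v /\ forall c : 'rV_n, c *m v = 0 -> c *m E = 0.

Lemma splits_change n (v : 'M[S]_(n, r)) E k (w : 'M_(k, r)) A C :
  splits v E -> v = A *m w -> w = C *m v -> splits w (C *m E *m A).
Proof.
move=> [Ev fE] vE wE; split; first by rewrite -2!mulmxA -vE Ev.
move=> c cw; rewrite 2!mulmxA fE ?mul0mx //.
by rewrite -mulmxA -wE.
Qed.

Lemma splitsM n (v : 'M[S]_(n, r)) E k (C : 'M_(k, n)) :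
  splits v E -> C *m v = 0 -> C *m E = 0.
Proof.
move=> [_ fE] Cv; apply/row_matrixP => i; rewrite row0 row_mul; apply: fE.
by rewrite -row_mul Cv row0.
Qed.

Lemma generates_change n (v : 'M[S]_(n, r)) k (w : 'M_(k, r)) A :
  generates v -> (forall i, N (row i w)) -> v = A *m w -> generates w.
Proof.
move=> [_ gv] Nw vE; split=> // u /gv[c ->].
by exists (c *m A); rewrite -mulmxA -vE.
Qed.

(* If the projection is the identity modulo the maximal ideal, then its
   determinant is a nonzero idempotent, so it is the identity. *)
Lemma splits_free n (v : 'M[S]_(n, r)) E :
  splits v E -> map_mx (mcoeff 0%MM) E = 1%:M -> is_free v.
Proof.
move=> sE E0; have EE : E *m E = E.
  apply/eqP; rewrite -subr_eq0 -[X in _ - X]mul1mx -mulmxBl; apply/eqP.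
  by apply: (splitsM sE); rewrite mulmxBl mul1mx sE.1 subrr.
have dE : \det E = 1.
  have dE0 : \det E != 0.
    apply: contra_eq_neq E0 => dE; apply/eqP => /(congr1 determinant).
    by rewrite det_map_mx dE raddf0 det1 => /esym/eqP; rewrite oner_eq0.
  by apply: (mulfI dE0); rewrite -det_mulmx EE mulr1.
have E1 : E = 1%:M.
  have uE : E \in unitmx by rewrite unitmxE dE unitr1.
  by rewrite -[LHS](mulKmx uE) EE mulVmx.
by move=> c /sE.2; rewrite E1 mulmx1.
Qed.

(** Induction on the number of generators: if [E] is not the identity modulo the maximal ideal, some
    row of [1 - E] is a relation with an entry of nonzero constant term, and the corresponding
    generator can be discarded. *)
Lemma free_of_homog_split n (v : 'M[S]_(n, r)) E (dg : 'I_n -> nat) :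
  generates v -> splits v E -> (forall i k, v i k \is (dg i).-homog) ->
  exists n' (v' : 'M_(n', r)), generates v' /\ is_free v'.
Proof.
elim: n => [|n IHn] in v E dg * => gv sE hv.
  by exists 0%N, v; split=> // c _; rewrite [c]thinmx0.
have [E1|] := eqVneq (map_mx (mcoeff 0%MM) E) 1%:M.
  by exists n.+1, v; split=> //; apply: splits_free sE E1.
move=> nE1; have [j [k nz]] : exists j k, ((1%:M - E) j k)@_0%MM != 0.
  have /existsP[j /existsP[k h]] : [exists j, exists k,
      ((1%:M - E) j k)@_0%MM != 0]; last by exists j, k.
  apply: contraR nE1; rewrite negb_exists => /forallP h.
  apply/eqP/matrixP => i k; have := h i; rewrite negb_exists.
  move=> /forallP/(_ k)/negPn/eqP; rewrite !mxE mcoeffB => /eqP.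
  rewrite subr_eq0 => /eqP <-.
  by rewrite mcoeffMn mcoeff1 eqxx.
set c := row j (1%:M - E); have cv : c *m v = 0.
  by rewrite -row_mul mulmxBl mul1mx sE.1 subrr row0.
(* In the part of degree [dg k] of the relation, the coefficient of generator [k] is reduced to its
   nonzero constant term. *)
have := eq_homog_row (dg k) c hv; set w := \row_i _; rewrite cv map_mx0.
move/esym => wv.
have wk : w 0 k = (((1%:M - E) j k)@_0%MM)%:MP.
  rewrite mxE leqnn subnn pihomog0E; congr (_@_0%MM)%:MP.
  by rewrite /c [LHS]mxE.
set x := _@_0%MM in nz wk.
(* [T] keeps the other generators and solves the relation for generator [k]. *)
pose T : 'M[S]_(n.+1, n) := \matrix_(i, i')
  if unlift k i is Some i0 then (i0 == i')%:R else - (x^-1 *: w 0 (lift k i')).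
have vT : v = T *m row' k v.
  apply/row_matrixP => i; rewrite row_mul mulmx_sum_row.
  have rE q : row q (row' k v) = row (lift k q) v.
    by apply/rowP => ?; rewrite !mxE.
  case: (unliftP k i) => [i0|] -> /=.
    rewrite (bigD1 i0) //= !mxE liftK eqxx scale1r rE big1 ?addr0 //.
    by move=> q ne; rewrite !mxE liftK eq_sym (negbTE ne) scale0r.
  have : x^-1%:MP *: (w *m v) = 0 by rewrite wv scaler0.
  rewrite mulmx_sum_row (bigD1_ord k) //= wk scalerDr scalerA -mpolyCM.
  rewrite mulVf // mpolyC1 scale1r => /eqP; rewrite addr_eq0 => /eqP ->.
  rewrite scaler_sumr -sumrN; apply: eq_bigr => q _.
  by rewrite !mxE unlift_none rE scalerA scaleNr -mul_mpolyC.
have vC : row' k v = row' k 1%:M *m v.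
  rewrite -[in LHS](mul1mx v); apply/matrixP => a b; rewrite !mxE.
  by apply: eq_bigr => q _; rewrite [in RHS]mxE.
apply: (IHn (row' k v) _ (fun i => dg (lift k i))).
- apply: (generates_change gv _ vT) => i.
  have -> : row i (row' k v) = row (lift k i) v.
    by apply/rowP => ?; rewrite !mxE.
  exact: gv.1.
- exact: splits_change sE vT vC.
by move=> i q; rewrite mxE.
Qed.

Hypothesis Npi : forall d u, N u -> N (map_mx (pi d) u).

(** Since [N] contains the homogeneous parts of its elements, the finitely many homogeneous parts of
    the generators still generate it, and the splitting carries over to them. *)
Lemma free_of_split n (v : 'M[S]_(n, r)) E :
  generates v -> splits v E ->
  exists n' (v' : 'M_(n', r)), generates v' /\ is_free v'.
Proof.
move=> gv sE.
pose B := \max_i \max_k msize (v i k).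
have leB i k : (msize (v i k) <= B)%N.
  apply: leq_trans (leq_bigmax i).
  exact: (leq_bigmax (F := fun k => msize (v i k))).
pose T := ('I_n * 'I_B)%type.
pose ev (x : 'I_#|{: T}|) : T := enum_val x.
pose w : 'M[S]_(#|{: T}|, r) :=
  \matrix_(x, k) pi (ev x).2 (v (ev x).1 k).
pose A : 'M[S]_(n, #|{: T}|) := \matrix_(i, x) ((ev x).1 == i)%:R.
have vE : v = A *m w.
  apply/matrixP => i k; rewrite mxE.
  under eq_bigr do rewrite !mxE.
  rewrite -(big_enum_val (A := {: T})
    (fun x : T => (x.1 == i)%:R * pi x.2 (v x.1 k))) /=.
  rewrite (eq_bigl xpredT) // -(pair_bigA _ (fun a b : 'I__ =>
     (a == i)%:R * pi b (v a k))) /=.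
  rewrite (bigD1 i) //= [X in _ + X]big1 ?addr0 => [|a /negbTE ->].
    rewrite {1}(pihomog_partitionE (leB i k)); apply: eq_bigr => b _.
    by rewrite eqxx mul1r.
  by rewrite big1 // => b _; rewrite mul0r.
have Nw x : N (row x w).
  have -> : row x w = map_mx (pi (ev x).2) (row (ev x).1 v).
    by apply/rowP => ?; rewrite !mxE.
  by apply: Npi; apply: gv.1.
have [C wE] := generatesM gv Nw.
apply: (free_of_homog_split (dg := fun x => (ev x).2)
  (generates_change gv Nw vE) (splits_change sE vE wE)).
by move=> i k; rewrite mxE pihomogP.
Qed.

End GradedModules.

(** * Hasse derivatives and logarithmic operators *)

Section Hasse.
Variables (K : fieldType) (l : nat).
Hypothesis charK : [pchar K] =i pred0.
Local Notation S := {mpoly K[l]}.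
Implicit Types (p q : S) (a u : 'X_{1..l}).

Lemma mnm_ind (P : 'X_{1..l} -> Prop) :
  P 0%MM -> (forall i u, P u -> P (U_(i) + u)%MM) -> forall u, P u.
Proof.
move=> P0 PS u; have [k] := ubnP (mdeg u); elim: k u => // k IHk u ltuk.
have [/eqP|nz] := eqVneq (mdeg u) 0%N; first by rewrite mdeg_eq0 => /eqP ->.
have [i ui] : exists i, u i != 0%N.
  apply/existsP; apply: contraR nz; rewrite negb_exists => /forallP h.
  by rewrite mdegE big1 // => i _; apply/eqP/negPn/h.
have uE : (U_(i) + (u - U_(i)))%MM = u by rewrite addmC submK // lep1mP.
rewrite -uE; apply: PS; apply: IHk.
by move: ltuk; rewrite -{1}uE mdegD mdeg1.
Qed.

Definition mfact a : nat := \prod_(i < l) (a i)`!.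
Definition mbinom u a : nat := \prod_(i < l) 'C(u i, a i).

(** Dividing by [a!] turns these operators into the coefficients of the Taylor expansion, so that
    their Leibniz rule has no binomial coefficients. *)
Definition hasse a p : S := (mfact a)%:R^-1 *: p^`M[a].

Lemma mfact_neq0 a : (mfact a)%:R != 0 :> K.
Proof.
rewrite ((pcharf0P K).1 charK) -lt0n.
by apply/prodn_gt0 => i; apply: fact_gt0.
Qed.

Lemma mcoeff_hasse a p u :
  (hasse a p)@_u = p@_(a + u) *+ mbinom (a + u)%MM a.
Proof.
rewrite mcoeffZ mcoeff_mderivm.
have -> : (\prod_(i < l) ((a + u)%MM i) ^_ (a i) =
           mbinom (a + u)%MM a * mfact a)%N.
  by rewrite -big_split /=; apply: eq_bigr => i _; rewrite bin_ffact.
by rewrite mulrnA -[X in _ * X]mulr_natl mulKf // mfact_neq0.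
Qed.

Lemma hasse0m p : hasse 0%MM p = p.
Proof.
by rewrite /hasse /mfact mderivm0m big1 ?invr1 ?scale1r // => i _; rewrite mnm0E.
Qed.

Lemma hasseZ a (c : K) p : hasse a (c *: p) = c *: hasse a p.
Proof. by rewrite /hasse linearZ /= !scalerA mulrC. Qed.

Lemma hasse_homog a p n : p \is n.-homog -> hasse a p \is (n - mdeg a).-homog.
Proof.
move=> hp; apply/dhomogP => u; rewrite mcoeff_msupp mcoeff_hasse => nz.
have : p@_(a + u) != 0 by apply: contra_neq nz => ->; rewrite mul0rn.
rewrite -mcoeff_msupp => /(dhomogP _ _ _ hp) /= dE.
by rewrite -dE -[mdeg (a + u)%MM]/(mdeg _) mdegD addnC addnK.
Qed.

Lemma hasseXX a : hasse a 'X_[a] = 1.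
Proof.
apply/mpolyP => u; rewrite mcoeff_hasse mcoeffX mcoeff1 -{1}[a]addm0 eqm_add2l.
rewrite eq_sym; case: eqP => [->|_]; last by rewrite mul0rn.
by rewrite addm0 /mbinom big1 // => i _; rewrite binn.
Qed.

Lemma hasseX_eq0 a u : a != u -> (mdeg u <= mdeg a)%N -> hasse a 'X_[u] = 0.
Proof.
move=> ne le; apply/mpolyP => w; rewrite mcoeff_hasse mcoeffX mcoeff0.
case: eqP => [uE|_]; last by rewrite mul0rn.
move: le ne; rewrite uE mdegD -{2}[mdeg a]addn0 leq_add2l leqn0 mdeg_eq0.
by move=> /eqP ->; rewrite addm0 eqxx.
Qed.

(* The Taylor expansion p(x + t), as a polynomial in t over K[x]: it is a ring
   morphism whose coefficients are the Hasse derivatives of p. *)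
Definition taylor : S -> {mpoly S[l]} :=
  mmap (@mpolyC l S \o @mpolyC l K) (fun i => ('X_i)%:MP + 'X_i).

HB.instance Definition _ := GRing.RMorphism.copy taylor
  (mmap (@mpolyC l S \o @mpolyC l K) (fun i => ('X_i)%:MP + 'X_i)).

Lemma taylorZ (c : K) p : taylor (c *: p) = c%:MP *: taylor p.
Proof. by rewrite /taylor mmapZ /= mul_mpolyC. Qed.

Lemma taylorD p q : taylor (p + q) = taylor p + taylor q.
Proof. exact: rmorphD. Qed.

Lemma taylorM p q : taylor (p * q) = taylor p * taylor q.
Proof. exact: rmorphM. Qed.

Lemma taylorXU i : taylor 'X_i = ('X_i)%:MP + 'X_i.
Proof. by rewrite /taylor mmapX mmap1U. Qed.

Lemma mderivXU (R : comNzRingType) (i j : 'I_l) :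
  ('X_i : {mpoly R[l]})^`M(j) = (i == j)%:R.
Proof.
rewrite mderivX mnm1E; case: eqP => [->|_]; last by rewrite scale0r.
suff -> : (U_(j) - U_(j) = 0)%MM by rewrite mpolyX0 scale1r.
by apply/mnmP=> k; rewrite mnmBE subnn mnm0E.
Qed.

(* Unification would otherwise unfold these morphisms into sums over supports. *)
Opaque taylor.

(** By linearity and the Leibniz rule it is enough to treat the variables: [x_j + t_j] has the same
    derivative in [t_i] as [x_j] in [x_i]. *)
Lemma taylor_deriv i p : (taylor p)^`M(i) = taylor p^`M(i).
Proof.
elim/mpolyind: p => [|c u p _ _ IHp]; first by rewrite !raddf0.
rewrite taylorD taylorZ !mderivD !mderivZ taylorD taylorZ.
congr (_ *: _ + _); last exact: IHp.
elim/mnm_ind: u => [|j u IHu].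
  by rewrite mpolyX0 rmorph1 -[1]mpolyC1 mderivC -[1]mpolyC1 mderivC raddf0.
rewrite mpolyXD taylorM !mderivM taylorD !taylorM.
congr (_ * _ + _ * _); last exact: IHu.
by rewrite taylorXU mderivD mderivC add0r !mderivXU rmorph_nat.
Qed.

Lemma taylor_derivm a p : (taylor p)^`M[a] = taylor p^`M[a].
Proof.
elim/mnm_ind: a p => [|i a IHa] p; first by rewrite !mderivm0m.
by rewrite !mderivmDm !mderivmU1m taylor_deriv IHa.
Qed.

Lemma mcoeff0_taylor p : (taylor p)@_0%MM = p.
Proof.
elim/mpolyind: p => [|c u p _ _ IHp]; first by rewrite !raddf0.
rewrite taylorD mcoeffD taylorZ mcoeffZ; congr (_ + _); last exact: IHp.
rewrite mul_mpolyC; congr (_ *: _); elim/mnm_ind: u => [|j u IHu].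
  by rewrite mpolyX0 rmorph1 mcoeff1 eqxx.
rewrite mpolyXD taylorM (rmorphM (mcoeff 0%MM)) /=; congr (_ * _); last exact: IHu.
by rewrite taylorXU mcoeffD mcoeffC eqxx mulr1 mcoeffX mnm1_eq0 addr0.
Qed.

(** Differentiating [a] times in [t] and setting [t = 0] multiplies the coefficient by [a!]; the
    same differentiation may be done in [x] before expanding. *)
Lemma mcoeff_taylor a p : (taylor p)@_a = hasse a p.
Proof.
have : ((taylor p)^`M[a])@_0%MM = p^`M[a].
  by rewrite taylor_derivm mcoeff0_taylor.
rewrite mcoeff_mderivm addm0.
have -> : (\prod_(i < l) (a i) ^_ (a i))%N = mfact a.
  by apply: eq_bigr => i _; rewrite ffactnn.
move=> pE; rewrite /hasse -pE -scaler_nat scalerA mulVf ?scale1r //.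
exact: mfact_neq0.
Qed.

Lemma hasseM b u p q : (mdeg u < b)%N ->
  hasse u (p * q) = \sum_(k : 'X_{1..l < b, b} | u == (k.1 + k.2)%MM)
    hasse k.1 p * hasse k.2 q.
Proof.
move=> ltub; rewrite -mcoeff_taylor taylorM.
rewrite [LHS](mcoeff_poly_mul _ _ ltub) /=.
by apply: eq_bigr => k _; rewrite !mcoeff_taylor.
Qed.

End Hasse.

Section Multiples.
Variables (K : fieldType) (l : nat).
Implicit Types Q p q : {mpoly K[l]}.

Definition mdvd Q p : Prop := exists q, p = Q * q.

Lemma mdvd0 Q : mdvd Q 0.
Proof. by exists 0; rewrite mulr0. Qed.

Lemma mdvd_refl Q : mdvd Q Q.
Proof. by exists 1; rewrite mulr1. Qed.

Lemma mdvdD Q p q : mdvd Q p -> mdvd Q q -> mdvd Q (p + q).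
Proof. by move=> [x ->] [y ->]; exists (x + y); rewrite mulrDr. Qed.

Lemma mdvdMl Q p q : mdvd Q p -> mdvd Q (q * p).
Proof. by move=> [x ->]; exists (q * x); rewrite mulrCA. Qed.

Lemma mdvdMr Q p q : mdvd Q p -> mdvd Q (p * q).
Proof. by rewrite mulrC; apply: mdvdMl. Qed.

Lemma mdvdB Q p q : mdvd Q p -> mdvd Q q -> mdvd Q (p - q).
Proof. by move=> Qp Qq; rewrite -mulN1r; apply/mdvdD/mdvdMl. Qed.

Lemma mdvd_sum Q (I : Type) (r : seq I) (P : pred I) (F : I -> {mpoly K[l]}) :
  (forall i, P i -> mdvd Q (F i)) -> mdvd Q (\sum_(i <- r | P i) F i).
Proof. by move=> h; elim/big_ind: _ => //; [apply: mdvd0 | apply: mdvdD]. Qed.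

Lemma mdvd_pihomog n d Q p : Q \is n.-homog -> mdvd Q p ->
  mdvd Q (pihomog mdeg d p).
Proof.
move=> hQ [q ->]; rewrite (pihomogM_homogl _ _ hQ).
by case: ifP => _; [apply/mdvdMr/mdvd_refl | apply: mdvd0].
Qed.

Lemma mdvdZ Q (c : K) p : c != 0 -> mdvd (c *: Q) p <-> mdvd Q p.
Proof.
move=> nz; split=> [[q ->]|[q ->]]; first by exists (c *: q); rewrite -scalerAl scalerAr.
by exists (c^-1 *: q); rewrite -scalerAl -scalerAr scalerA divff // scale1r.
Qed.

End Multiples.

Section LogCoefficients.
Variables (K : fieldType) (l : nat).
Hypothesis charK : [pchar K] =i pred0.
Local Notation S := {mpoly K[l]}.
Implicit Types (Q p : S) (g h : 'X_{1..l} -> S).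

Definition hop m g p : S :=
  \sum_(a : 'X_{1..l < m.+1} | mdeg a == m) g a * hasse a p.

(* The value at Q of the iterated commutator of [hop m g] with 'X_[c], up to a
   scalar. *)
Definition logsum m Q g (c : 'X_{1..l}) : S :=
  \sum_(a : 'X_{1..l < m.+1} | (mdeg a + mdeg c == m)%N)
     g (a + c)%MM * hasse a Q.

Definition logcoef m Q g : Prop := forall c, mdvd Q (logsum m Q g c).

Lemma logsum_eq0 m Q g c : (m < mdeg c)%N -> logsum m Q g c = 0.
Proof.
by move=> lt; rewrite /logsum big_pred0 // => a; apply/eqP; lia.
Qed.

(** This is the Leibniz rule, grouped by the derivative [c] that falls on [p]. *)
Lemma hopM m Q g p :
  hop m g (Q * p) = \sum_(c : 'X_{1..l < m.+1}) logsum m Q g c * hasse c p.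
Proof.
rewrite /hop /logsum.
rewrite (eq_bigr (fun u : 'X_{1..l < m.+1} => \sum_(k : 'X_{1..l < m.+1, m.+1})
    (if (u == k.1 + k.2 :> 'X_{1..l})%MM then g u * (hasse k.1 Q * hasse k.2 p) else 0)));
  last first.
  move=> u /eqP du; rewrite (hasseM charK _ _ (bmdeg u)) mulr_sumr.
  by rewrite big_mkcond.
rewrite exchange_big /=.
rewrite (eq_bigr (fun k : 'X_{1..l < m.+1, m.+1} =>
  if (mdeg k.1 + mdeg k.2 == m)%N
  then g (k.1 + k.2)%MM * hasse k.1 Q * hasse k.2 p else 0)); last first.
  move=> k _; rewrite -big_mkcondr /=; case: eqP => [dk|ndk].
    have ltk : (mdeg (k.1 + k.2)%MM < m.+1)%N by rewrite mdegD dk.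
    rewrite (big_pred1 (BMultinom ltk)) /= ?mulrA // => u /=.
    rewrite bmeqP /=; apply: andb_idl => /eqP ->.
    by rewrite mdegD dk.
  by rewrite big_pred0 // => u; apply/negP => /andP[/eqP du /eqP uE]; rewrite uE mdegD in du.
rewrite -(pair_bigA _ (fun a c : 'X_{1..l < m.+1} => if (mdeg a + mdeg c == m)%N
  then g (a + c)%MM * hasse a Q * hasse c p else 0)) /= exchange_big /=.
by apply: eq_bigr => c _; rewrite mulr_suml -big_mkcond.
Qed.

(** One direction is [hopM]. For the other, test the operator on ['X_[c]], by induction on the
    degree of [c]: the term of index [c] has factor 1, those of smaller degree are covered by
    induction, and the remaining ones vanish. *)
Lemma logcoefP m Q g :
  logcoef m Q g <-> forall p, mdvd Q (hop m g (Q * p)).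
Proof.
split=> [hg p|hg c]; first by rewrite hopM; apply: mdvd_sum => c _; apply: mdvdMr.
have [k] := ubnP (mdeg c); elim: k c => // k IHk c ltck.
have [lt|le] := ltnP m (mdeg c); first by rewrite logsum_eq0 //; apply: mdvd0.
have := hg 'X_[c]; rewrite hopM (bigD1 (BMultinom (le : mdeg c < m.+1)%N)) //=.
rewrite (hasseXX charK) mulr1; set s := (X in _ + X) => hs.
rewrite -(addrK s (logsum _ _ _ _)); apply: mdvdB hs _.
apply: mdvd_sum => c'; rewrite bmeqP /= => ne.
have [le'|lt'] := leqP (mdeg c) (mdeg c').
  by rewrite (hasseX_eq0 charK) // mulr0; apply: mdvd0.
by apply/mdvdMr/IHk; apply: leq_trans lt' _.
Qed.

Lemma hopX m g (a : 'X_{1..l}) : mdeg a = m -> hop m g 'X_[a] = g a.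
Proof.
move=> da; have lta : (mdeg a < m.+1)%N by rewrite da.
rewrite /hop (bigD1 (BMultinom lta)) /= ?da // (hasseXX charK) mulr1.
rewrite big1 ?addr0 // => u /andP[/eqP du]; rewrite bmeqP /= => ne.
by rewrite (hasseX_eq0 charK) ?mulr0 // du da.
Qed.

Lemma logcoefM m Q p g : logcoef m Q g -> logcoef m Q (fun a => p * g a).
Proof.
move=> hg c; rewrite /logsum; under eq_bigr do rewrite -mulrA.
by rewrite -mulr_sumr; apply: mdvdMl; apply: hg.
Qed.

Lemma logcoef_mdvd m Q g : (forall a, mdvd Q (g a)) -> logcoef m Q g.
Proof. by move=> hg c; apply: mdvd_sum => a _; apply/mdvdMr/hg. Qed.

Lemma logcoef_m0 Q g : logcoef 0 Q g.
Proof.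
move=> c; apply: mdvd_sum => a; rewrite addn_eq0 => /andP[]; rewrite mdeg_eq0.
by move=> /eqP -> _; rewrite hasse0m; apply/mdvdMl/mdvd_refl.
Qed.

Lemma logcoefZ m Q g (c : K) : c != 0 -> logcoef m (c *: Q) g <-> logcoef m Q g.
Proof.
move=> nz; have sE d : logsum m (c *: Q) g d = c *: logsum m Q g d.
  by rewrite scaler_sumr; apply: eq_bigr => a _; rewrite hasseZ -scalerAr.
have nzV : c^-1 != 0 by rewrite invr_neq0.
split=> hg d; have := hg d; rewrite sE mdvdZ //.
  by move/(mdvdMl c^-1%:MP); rewrite mul_mpolyC scalerA mulVf // scale1r.
by move/(mdvdMl c%:MP); rewrite mul_mpolyC.
Qed.

Lemma logcoef_pihomog m Q n g d : Q \is n.-homog ->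
  logcoef m Q g -> logcoef m Q (fun a => pihomog mdeg d (g a)).
Proof.
(* All terms of [logsum] have [mdeg a = m - mdeg c], so their factors [hasse a Q] share the degree
   [e]. *)
move=> hQ hg c; set e := (n - (m - mdeg c))%N.
suff -> : logsum m Q (fun a => pihomog mdeg d (g a)) c =
    pihomog mdeg (d + e) (logsum m Q g c) by apply: mdvd_pihomog hQ (hg c).
rewrite linear_sum /=; apply: eq_bigr => a /eqP da.
rewrite (pihomogM_homog _ _ (hasse_homog charK a hQ)).
have -> : (n - mdeg a)%N = e by rewrite /e; congr (_ - _)%N; lia.
by rewrite leq_addl addnK.
Qed.

(** Families are compared at multi-indices of degree [m] only, as no other value enters an operator
    of order [m]. The index type is arbitrary so that tensor products keep their natural
    indexing. *)
Definition islogbasis m Q (T : finType) (g : T -> 'X_{1..l} -> S) : Prop :=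
  [/\ forall t, logcoef m Q (g t),
      forall h, logcoef m Q h -> exists c : T -> S,
        forall a, mdeg a = m -> h a = \sum_t c t * g t a
    & forall c : T -> S,
        (forall a, mdeg a = m -> \sum_t c t * g t a = 0) -> forall t, c t = 0].

Lemma islogbasisZ m Q (T : finType) (g : T -> 'X_{1..l} -> S) (c : K) :
  c != 0 -> islogbasis m (c *: Q) g <-> islogbasis m Q g.
Proof.
move=> nz; split=> -[gD gS gF]; split=> // [t|h hh].
- exact/(logcoefZ m Q (g t) nz).
- exact/gS/logcoefZ.
- exact/logcoefZ.
- exact/gS/(logcoefZ m Q h nz).
Qed.

Lemma islogbasis_bij m Q (T T' : finType) (g : T -> 'X_{1..l} -> S)
    (f : T' -> T) : bijective f -> islogbasis m Q g -> islogbasis m Q (g \o f).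
Proof.
move=> [f' f'K fK] [gD gS gF]; have bf : bijective f by exists f'.
have reE (F : T -> S) : \sum_t F t = \sum_t F (f t).
  by rewrite (reindex f) //; apply: onW_bij.
split=> [t|h /gS[c hc]|c hc t]; first exact: gD.
  by exists (c \o f) => a /hc ->; rewrite reE.
rewrite -[t]f'K; apply: (gF (c \o f')) => a /hc {2}<-.
by rewrite reE; apply: eq_bigr => i _; rewrite /= f'K.
Qed.

(** Operators of order 0 are multiplications, which all preserve [QS]; the basis element 1 agrees
    with the convention on [exp_0]. *)
Lemma logbasis_m0 Q :
  islogbasis 0 Q (fun (_ : 'I_1) (_ : 'X_{1..l}) => 1 : S).
Proof.
split=> [_|h _|c hc t]; first exact: logcoef_m0.
  exists (fun=> h 0%MM) => a /eqP; rewrite mdeg_eq0 => /eqP ->.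
  by rewrite big_ord1 mulr1.
have d0 : mdeg (0%MM : 'X_{1..l}) = 0%N by rewrite mdeg0.
by have := hc _ d0; rewrite big_ord1 mulr1 [t]ord1 => ->.
Qed.

End LogCoefficients.

(** * Splitting the variables *)

Section Splitting.

(* A splitting of n variables into p variables x and q variables y, seen on
   monomials; [swap] exchanges the roles of x and y. *)
Record splitting (p q n : nat) := Splitting {
  mcat : 'X_{1..p} -> 'X_{1..q} -> 'X_{1..n};
  mpl : 'X_{1..n} -> 'X_{1..p};
  mpr : 'X_{1..n} -> 'X_{1..q};
  mcatKl : forall a b, mpl (mcat a b) = a;
  mcatKr : forall a b, mpr (mcat a b) = b;
  mcatK : forall u, mcat (mpl u) (mpr u) = u;
  mcatD : forall a b a' b',
    mcat (a + a')%MM (b + b')%MM = (mcat a b + mcat a' b')%MM;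
  mdeg_cat : forall a b, mdeg (mcat a b) = (mdeg a + mdeg b)%N;
  mbinom_cat : forall u v a b,
    mbinom (mcat u v) (mcat a b) = (mbinom u a * mbinom v b)%N }.

Definition swap p q n (s : splitting p q n) : splitting q p n.
Proof.
apply: (@Splitting q p n (fun a b => mcat s b a) (mpr s) (mpl s)).
- by move=> a b; apply: mcatKr.
- by move=> a b; apply: mcatKl.
- exact: mcatK.
- by move=> a b a' b'; apply: mcatD.
- by move=> a b; rewrite mdeg_cat addnC.
- by move=> u v a b; rewrite mbinom_cat mulnC.
(* Transparent, so that the operations of [swap (swap s)] reduce to those of [s]. *)
Defined.

Variables (K : fieldType) (p q n : nat) (s : splitting p q n).
Local Notation S := {mpoly K[n]}.

Lemma mcat_inj a b a' b' : mcat s a b = mcat s a' b' -> a = a' /\ b = b'.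
Proof.
move=> h; split; first by rewrite -(mcatKl s a b) h mcatKl.
by rewrite -(mcatKr s a b) h mcatKr.
Qed.

Lemma eq_mcat u a b : (u == mcat s a b) = (mpl s u == a) && (mpr s u == b).
Proof.
apply/eqP/andP => [->|[/eqP <- /eqP <-]]; first by rewrite mcatKl mcatKr.
by rewrite mcatK.
Qed.

Lemma mcat0 : mcat s 0%MM 0%MM = 0%MM.
Proof. by apply/eqP; rewrite -mdeg_eq0 mdeg_cat !mdeg0. Qed.

Lemma mplD u v : mpl s (u + v)%MM = (mpl s u + mpl s v)%MM.
Proof. by rewrite -{1}(mcatK s u) -{1}(mcatK s v) -mcatD mcatKl. Qed.

Lemma mprD u v : mpr s (u + v)%MM = (mpr s u + mpr s v)%MM.
Proof. by rewrite -{1}(mcatK s u) -{1}(mcatK s v) -mcatD mcatKr. Qed.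

Lemma mpl0 : mpl s 0%MM = 0%MM. Proof. by rewrite -mcat0 mcatKl. Qed.
Lemma mpr0 : mpr s 0%MM = 0%MM. Proof. by rewrite -mcat0 mcatKr. Qed.

Definition minj : {mpoly K[p]} -> S :=
  mmap (@mpolyC n K) (fun i => 'X_[mcat s U_(i)%MM 0%MM]).

HB.instance Definition _ := GRing.RMorphism.copy minj
  (mmap (@mpolyC n K) (fun i => 'X_[mcat s U_(i)%MM 0%MM])).

Lemma minjD f g : minj (f + g) = minj f + minj g.
Proof. exact: rmorphD. Qed.

Lemma minjM f g : minj (f * g) = minj f * minj g.
Proof. exact: rmorphM. Qed.

Lemma minjX a : minj 'X_[a] = 'X_[mcat s a 0%MM].
Proof.
elim/mnm_ind: a => [|i a IHa]; first by rewrite mpolyX0 rmorph1 mcat0 mpolyX0.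
rewrite mpolyXD minjM IHa -{2}[0%MM]addm0 mcatD mpolyXD; congr (_ * _).
by rewrite /minj mmapX mmap1U.
Qed.

Lemma minjZ (c : K) f : minj (c *: f) = c *: minj f.
Proof. by rewrite /minj mmapZ mul_mpolyC. Qed.

(* The same polynomial, read as a polynomial in y over K[x]. *)
Definition mexp : S -> {mpoly {mpoly K[p]}[q]} :=
  mmap (@mpolyC q {mpoly K[p]} \o @mpolyC p K)
    (fun i => 'X_[mpl s U_(i)%MM]%:MP * 'X_[mpr s U_(i)%MM]).

HB.instance Definition _ := GRing.RMorphism.copy mexp
  (mmap (@mpolyC q {mpoly K[p]} \o @mpolyC p K)
    (fun i => 'X_[mpl s U_(i)%MM]%:MP * 'X_[mpr s U_(i)%MM])).

Lemma mexpD f g : mexp (f + g) = mexp f + mexp g.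
Proof. exact: rmorphD. Qed.

Lemma mexpM f g : mexp (f * g) = mexp f * mexp g.
Proof. exact: rmorphM. Qed.

Lemma mexpX u : mexp 'X_[u] = 'X_[mpl s u]%:MP * 'X_[mpr s u].
Proof.
elim/mnm_ind: u => [|i u IHu].
  by rewrite mpolyX0 rmorph1 mpl0 mpr0 !mpolyX0 mulr1 mpolyC1.
rewrite mpolyXD mexpM IHu mplD mprD !mpolyXD mpolyCM mulrACA.
by congr (_ * _); rewrite /mexp mmapX mmap1U.
Qed.

Lemma mexpZ (c : K) f : mexp (c *: f) = c%:MP *: mexp f.
Proof. by rewrite /mexp mmapZ /= mul_mpolyC. Qed.

Definition ycoef (b : 'X_{1..q}) (z : S) : {mpoly K[p]} := (mexp z)@_b.

Lemma mcoeff_ycoef b z a : (ycoef b z)@_a = z@_(mcat s a b).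
Proof.
rewrite /ycoef; elim/mpolyind: z => [|c u z _ _ IHz]; first by rewrite !raddf0.
rewrite mexpD !mcoeffD; congr (_ + _); last exact: IHz.
rewrite mexpZ (mcoeffZ c%:MP) mexpX !mcoeffCM mcoeffX mcoeffZ mcoeffX eq_mcat.
by rewrite mulr_natr mcoeffMn mcoeffX -mulnb natrM mulr_natr.
Qed.

Lemma ycoefP z z' : (forall b, ycoef b z = ycoef b z') -> z = z'.
Proof.
by move=> h; apply/mpolyP => u; rewrite -(mcatK s u) -!mcoeff_ycoef h.
Qed.

Lemma mcoeff_minj f a b : (minj f)@_(mcat s a b) = f@_a * (b == 0%MM)%:R.
Proof.
elim/mpolyind: f => [|c u f _ _ IHf]; first by rewrite !raddf0 mul0r.
rewrite minjD !mcoeffD mulrDl; congr (_ + _); last exact: IHf.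
rewrite minjZ minjX !mcoeffZ !mcoeffX eq_sym eq_mcat mcatKl mcatKr -mulrA.
by rewrite -mulnb natrM [u == a]eq_sym.
Qed.

Lemma mexp_minj f : mexp (minj f) = f%:MP.
Proof.
apply/mpolyP => b; apply/mpolyP => a; rewrite -/(ycoef b _) mcoeff_ycoef.
by rewrite mcoeff_minj mcoeffC !mulr_natr mcoeffMn.
Qed.

End Splitting.

Opaque minj mexp.

Section SplittingTheory.
Variables (K : fieldType) (p q n : nat) (s : splitting p q n).
Hypothesis charK : [pchar K] =i pred0.
Local Notation S := {mpoly K[n]}.
Local Notation inl := (@minj K _ _ _ s).
Local Notation inr := (@minj K _ _ _ (swap s)).
Local Notation yc := (@ycoef K _ _ _ s).

Lemma mexp_minjr (g : {mpoly K[q]}) :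
  mexp s (inr g) = map_mpoly (@mpolyC p K) g.
Proof.
apply/mpolyP => b; apply/mpolyP => a.
rewrite -/(ycoef s b _) mcoeff_ycoef -[mcat s a b]/(mcat (swap s) b a).
by rewrite mcoeff_minj mcoeff_map_mpoly mcoeffC.
Qed.

Lemma ycoefD b (z z' : S) : yc b (z + z') = yc b z + yc b z'.
Proof. by rewrite /ycoef raddfD mcoeffD. Qed.

Lemma ycoef0 b : yc b 0 = 0.
Proof. by rewrite /ycoef !raddf0. Qed.

Lemma ycoef_sum b (I : Type) (r : seq I) (P : pred I) (F : I -> S) :
  yc b (\sum_(i <- r | P i) F i) = \sum_(i <- r | P i) yc b (F i).
Proof. exact: (big_morph (yc b) (ycoefD b) (ycoef0 b)). Qed.

Lemma ycoefMl b f (z : S) : yc b (inl f * z) = f * yc b z.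
Proof. by rewrite /ycoef mexpM mexp_minj mcoeffCM. Qed.

Lemma ycoefMinj b f g : yc b (inl f * inr g) = f * (g@_b)%:MP.
Proof. by rewrite ycoefMl /ycoef mexp_minjr mcoeff_map_mpoly. Qed.

Lemma mcoeffMinj f g a b : (inl f * inr g)@_(mcat s a b) = f@_a * g@_b.
Proof. by rewrite -mcoeff_ycoef ycoefMinj mulrC mcoeffCM mulrC. Qed.

(** The lowest part of [z] in [y] meets only the part of [c] that is free of [y]. *)
Lemma ycoef_mul_low (b : 'X_{1..q}) (c z : S) :
  (forall b' : 'X_{1..q}, (mdeg b' < mdeg b)%N -> yc b' z = 0) ->
  yc b (c * z) = yc 0%MM c * yc b z.
Proof.
move=> low; rewrite {1}/ycoef mexpM mcoeffM.
have lt0 : (mdeg (0%MM : 'X_{1..q}) < (mdeg b).+1)%N by rewrite mdeg0.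
rewrite (bigD1 (BMultinom lt0, BMultinom (ltnSn (mdeg b)))) /=; last by rewrite add0m.
rewrite [X in _ + X]big1 ?addr0 // => -[k k'] /= /andP[/eqP bE ne].
have dE : mdeg b = (mdeg k + mdeg k')%N by rewrite -mdegD -bE.
rewrite -/(ycoef s k' z) low ?mulr0 //.
suff : (0 < mdeg k)%N by lia.
rewrite lt0n mdeg_eq0; apply: contraNneq ne => k0.
rewrite -pair_eqE /= !bmeqP /= k0 eqxx /=.
by move: bE; rewrite k0 add0m => /esym/eqP.
Qed.

Lemma mexpand k (z : S) : (msize (mexp s z) <= k)%N ->
  z = \sum_(b : 'X_{1..q < k}) inl (yc b z) * inr 'X_[b].
Proof.
move=> le; apply: (@ycoefP K _ _ _ s) => b; rewrite {1}/ycoef.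
rewrite {1}(mpolywE le) ycoef_sum (raddf_sum (mcoeff b)) /=.
apply: eq_bigr => b' _; rewrite mcoeffZ mcoeffX ycoefMinj mcoeffX /=.
by rewrite mpolyC_nat.
Qed.

(** As [Q] involves only [x], multiplication by it acts separately on each coefficient in [y]. *)
Lemma mdvd_minj Q (z : S) : mdvd (inl Q) z <-> forall b, mdvd Q (yc b z).
Proof.
split=> [[w ->] b|h]; first by exists (yc b w); rewrite ycoefMl.
have [w hw] := fin_all_exists
  (fun b : 'X_{1..q < msize (mexp s z)} => h (b : 'X_{1..q})).
exists (\sum_(b : 'X_{1..q < msize (mexp s z)}) inl (w b) * inr 'X_[b]).
rewrite {1}(mexpand (leqnn (msize (mexp s z)))) mulr_sumr.
by apply: eq_bigr => b _; rewrite hw minjM mulrA.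
Qed.

Lemma hasse_minj a b f g :
  hasse (mcat s a b) (inl f * inr g) = inl (hasse a f) * inr (hasse b g).
Proof.
apply/mpolyP => u; rewrite -(mcatK s u); move: (mpl s u) (mpr s u) => c d.
rewrite mcoeffMinj !mcoeff_hasse // -mcatD mcoeffMinj mbinom_cat.
by rewrite mulnC mulrnA [RHS]mulrnAl mulrnAr.
Qed.

End SplittingTheory.

(** * Coprimality of polynomials in disjoint variables *)

Section Cancel.
Variables (K : fieldType) (p q n : nat).
Local Notation R := {mpoly K[q]}.

(** The leading coefficient of [f] is a unit of [K], so [Q] divides the leading coefficient of [Z];
    subtract the leading term of [Z] and repeat. *)
Lemma mdvd_coef_cancel (f : {mpoly K[p]}) (Q : R) (Z : {mpoly R[p]}) :
  f != 0 ->
  (forall a, mdvd Q (map_mpoly (@mpolyC q K) f * Z)@_a) ->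
  forall a, mdvd Q Z@_a.
Proof.
move=> nzf; set A := map_mpoly _ f; elim/mleadrect: Z => Z IHZ AZ.
have nzA : f@_(mlead A) != 0.
  have : A != 0.
    apply: contra_neq nzf => /mpolyP A0; apply/mpolyP => a.
    have := A0 a; rewrite mcoeff_map_mpoly !mcoeff0.
    by move/eqP; rewrite mpolyC_eq0 => /eqP.
  by rewrite -mleadc_eq0 mcoeff_map_mpoly mpolyC_eq0.
have lcZ : mdvd Q (mleadc Z).
  have := AZ (mlead A + mlead Z)%MM; rewrite mleadcM mcoeff_map_mpoly.
  move/(mdvdMl (f@_(mlead A))^-1%:MP).
  by rewrite mulrA -mpolyCM mulVf // mpolyC1 mul1r.
set L := mleadc Z *: 'X_[mlead Z]; have hL a : mdvd Q L@_a.
  by rewrite mcoeffZ; apply: mdvdMr.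
have [Z0 a|nz a] := eqVneq (Z - L) 0.
  by have := hL a; rewrite -(subr0_eq Z0).
rewrite -(subrK L Z) mcoeffD; apply: mdvdD (hL a); apply: IHZ => [|b].
  apply: ltm_mleadD => //; apply: contra_neq nz => Z0.
  by rewrite /L Z0 mcoeff0 scale0r subrr.
rewrite mulrBr mcoeffB; apply: mdvdB (AZ b) _.
by rewrite /L -scalerAr mcoeffZ; apply: mdvdMr.
Qed.

Lemma mdvd_minj_cancel (s : splitting p q n) (f : {mpoly K[p]}) (Q : R) z :
  f != 0 -> mdvd (minj (swap s) Q) (minj s f * z) -> mdvd (minj (swap s) Q) z.
Proof.
move=> nzf /mdvd_minj h; apply/mdvd_minj => a.
apply: (mdvd_coef_cancel nzf) => b; have := h b.
rewrite /ycoef mexpM -[minj s f]/(minj (swap (swap s)) f).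
by rewrite mexp_minjr.
Qed.

End Cancel.

(** Used to change the bound in a sum over multi-indices, and to split a multi-index into its two
    blocks. *)
Lemma big_bmnm (R : nmodType) k l (I : finType) (e : I -> 'X_{1..l})
    (P : pred I) (PP : pred 'X_{1..l}) (F : 'X_{1..l} -> R) :
  injective e -> (forall u, PP u -> (mdeg u < k)%N) ->
  (forall u, PP u -> exists2 i, P i & e i = u) ->
  (forall i, P i -> PP (e i)) ->
  \sum_(u : 'X_{1..l < k} | PP u) F u = \sum_(i | P i) F (e i).
Proof.
move=> inj_e ltk sur dom; rewrite -big_filter -[RHS]big_filter.
rewrite -(big_map (@bmnm l k) xpredT F) -(big_map e xpredT F).
apply/perm_big/uniq_perm => [||u].
- by rewrite map_inj_uniq ?filter_uniq ?index_enum_uniq //; apply: val_inj.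
- by rewrite map_inj_uniq ?filter_uniq ?index_enum_uniq.
apply/mapP/mapP => [[v]|[i]]; rewrite mem_filter => /andP[].
  move=> Pv _ ->; have [i Pi <-] := sur _ Pv.
  by exists i; rewrite // mem_filter Pi mem_index_enum.
move=> /dom Pi _ ->; exists (BMultinom (ltk _ Pi)) => //.
by rewrite mem_filter Pi mem_index_enum.
Qed.

(** * Extension of scalars *)

Section Extension.
Variables (K : fieldType) (p q n : nat) (s : splitting p q n).
Hypothesis charK : [pchar K] =i pred0.
Local Notation S := {mpoly K[n]}.
Local Notation inl := (@minj K _ _ _ s).
Local Notation inr := (@minj K _ _ _ (swap s)).
Local Notation yc := (@ycoef K _ _ _ s).
Implicit Types (g : 'X_{1..p} -> S) (Q : {mpoly K[p]}).

Definition elogsum i Q g (c : 'X_{1..p}) : S :=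
  \sum_(a : 'X_{1..p < i.+1} | (mdeg a + mdeg c == i)%N)
     g (a + c)%MM * inl (hasse a Q).

(* [g] has its coefficients in S but only derives in x: this is membership in
   the module of logarithmic operators of Q with scalars extended to S. *)
Definition elogcoef i Q g : Prop := forall c, mdvd (inl Q) (elogsum i Q g c).

Lemma ycoef_elogsum i Q g c b :
  yc b (elogsum i Q g c) = logsum i Q (fun a => yc b (g a)) c.
Proof.
rewrite /elogsum ycoef_sum; apply: eq_bigr => a _.
by rewrite mulrC ycoefMl mulrC.
Qed.

Lemma elogcoefP i Q g :
  elogcoef i Q g <-> forall b, logcoef i Q (fun a => yc b (g a)).
Proof.
split=> [h b c|h c]; first by have /mdvd_minj := h c; rewrite -ycoef_elogsum; apply.
by apply/mdvd_minj => b; rewrite ycoef_elogsum; apply: h.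
Qed.

Variables (T : finType) (i : nat) (Q : {mpoly K[p]}).
Variable g : T -> 'X_{1..p} -> {mpoly K[p]}.
Hypothesis gB : islogbasis i Q g.

Lemma logbasis_span_ext (h : 'X_{1..p} -> S) : elogcoef i Q h ->
  exists c : T -> S,
    forall a, mdeg a = i -> h a = \sum_t c t * inl (g t a).
Proof.
move=> /elogcoefP hh.
(* A common bound on the degrees in [y] of all coefficients of order [i], so that finitely many
   monomials in [y] suffice. *)
pose k := (\max_(a : 'X_{1..p < i.+1}) msize (mexp s (h a)))%N.
have lek (a : 'X_{1..p}) : mdeg a = i -> (msize (mexp s (h a)) <= k)%N.
  move=> da; have lta : (mdeg a < i.+1)%N by rewrite da.
  exact: (leq_bigmax (F := fun a : 'X_{1..p < i.+1} => msize (mexp s (h a)))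
    (BMultinom lta)).
have [_ gS _] := gB.
have [c hc] := fin_all_exists (fun b : 'X_{1..q < k} => gS _ (hh b)).
exists (fun t => \sum_b inl (c b t) * inr 'X_[b]) => a da.
rewrite (mexpand (lek a da)).
rewrite (eq_bigr (fun b : 'X_{1..q < k} =>
  \sum_t inl (c b t) * inr 'X_[b] * inl (g t a))); last first.
  move=> b _; rewrite (hc b a da) (rmorph_sum (minj s)) /= mulr_suml.
  by apply: eq_bigr => t _; rewrite minjM mulrAC.
by rewrite exchange_big; apply: eq_bigr => t _; rewrite mulr_suml.
Qed.

Lemma logbasis_free_ext (c : T -> S) :
  (forall a, mdeg a = i -> \sum_t c t * inl (g t a) = 0) ->
  forall t, c t = 0.
Proof.
move=> h t; apply: (@ycoefP K _ _ _ s) => b; rewrite ycoef0.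
have [_ _ gF] := gB; apply: (gF (fun t => yc b (c t))) => a da.
have := congr1 (yc b) (h a da); rewrite ycoef0 ycoef_sum.
apply: etrans; apply: eq_bigr => t' _.
by rewrite [in RHS]mulrC ycoefMl mulrC.
Qed.

(* The basis spans Q times the free module, so the matrix of its coefficients
   has an inverse up to the factor Q, which is a nonzerodivisor modulo a
   polynomial in y. *)
Lemma logbasis_cancel (Q2 : {mpoly K[q]}) (z : T -> S) : Q != 0 ->
  (forall a, mdeg a = i -> mdvd (inr Q2) (\sum_t inl (g t a) * z t)) ->
  forall t, mdvd (inr Q2) (z t).
Proof.
move=> nzQ hz; have [_ gS gF] := gB.
(* [Q] times a unit vector is logarithmic; its coordinates [U a] in the basis form a left inverse of
   [g] up to the factor [Q]. *)
have QD (a : 'X_{1..p < i.+1}) :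
    logcoef i Q (fun b => if b == a :> 'X_{1..p} then Q else 0).
  by apply: logcoef_mdvd => b; case: ifP => _; [apply: mdvd_refl|apply: mdvd0].
have [U hU] := fin_all_exists (fun a => gS _ (QD a)).
(* Freeness of the basis makes [U] a right inverse as well, up to the same factor. *)
have gU k t : \sum_(a : 'X_{1..p < i.+1} | mdeg a == i) g k a * U a t =
    (if t == k then Q else 0).
  apply/eqP; rewrite -subr_eq0; apply/eqP.
  apply: (gF (fun t => \sum_(a : 'X_{1..p < i.+1} | mdeg a == i)
    g k a * U a t - (if t == k then Q else 0))) => b db.
  under eq_bigr do rewrite mulrBl mulr_suml.
  rewrite sumrB [X in _ - X](bigD1 k) //= eqxx [X in _ - (_ + X)]big1 => [|t' /negbTE ->];
    last by rewrite mul0r.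
  rewrite addr0 exchange_big /=.
  rewrite (eq_bigr (fun a : 'X_{1..p < i.+1} =>
    g k a * (if b == a :> 'X_{1..p} then Q else 0))); last first.
    move=> a _; rewrite (hU a b db) mulr_sumr.
    by apply: eq_bigr => t' _; rewrite mulrA.
  have ltb : (mdeg b < i.+1)%N by rewrite db.
  rewrite (bigD1 (BMultinom ltb)) /= ?db // eqxx big1 ?addr0.
    by rewrite mulrC subrr.
  move=> a /andP[_]; rewrite bmeqP /= eq_sym => /negbTE ->.
  by rewrite mulr0.
move=> t; apply: (mdvd_minj_cancel nzQ).
have -> : inl Q * z t = \sum_(a : 'X_{1..p < i.+1} | mdeg a == i)
    inl (U a t) * \sum_k inl (g k a) * z k.
  under eq_bigr do rewrite mulr_sumr.
  rewrite exchange_big /= (bigD1 t) //= [X in _ + X]big1 => [|k ne].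
    have QE := gU t t; rewrite eqxx in QE.
    rewrite addr0 -[in LHS]QE (rmorph_sum (minj s)) mulr_suml /=.
    by apply: eq_bigr => a _; rewrite minjM mulrA [inl _ * inl _]mulrC.
  transitivity (inl (\sum_(a : 'X_{1..p < i.+1} | mdeg a == i) g k a * U a t) * z k).
    rewrite (rmorph_sum (minj s)) mulr_suml /=.
    by apply: eq_bigr => a _; rewrite minjM mulrA [inl _ * inl _]mulrC.
  by rewrite gU eq_sym (negbTE ne) raddf0 mul0r.
by apply: mdvd_sum => a /eqP da; apply/mdvdMl/hz.
Qed.

End Extension.

Section Product.
Variables (K : fieldType) (p q n : nat) (s : splitting p q n).
Hypothesis charK : [pchar K] =i pred0.
Local Notation S := {mpoly K[n]}.
Local Notation inl := (@minj K _ _ _ s).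
Local Notation inr := (@minj K _ _ _ (swap s)).
Local Notation yc := (@ycoef K _ _ _ s).
Variables (Q1 : {mpoly K[p]}) (Q2 : {mpoly K[q]}).
Local Notation Q := (inl Q1 * inr Q2).
Implicit Types h : 'X_{1..n} -> S.

(** Hasse derivatives of [Q] factor into a derivative of [Q1] and one of [Q2]; the terms are
    collected by the derivative [b] in [y]. *)
Lemma logsum_cat m h c d :
  logsum m Q h (mcat s c d) =
  \sum_(b : 'X_{1..q < m.+1} | (mdeg b + mdeg d <= m)%N)
    inr (hasse b Q2) *
    elogsum s (m - (mdeg b + mdeg d)) Q1 (fun a => h (mcat s a (b + d)%MM)) c.
Proof.
pose e (x : 'X_{1..p < m.+1} * 'X_{1..q < m.+1}) := mcat s x.1 x.2.
have inj_e : injective e.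
  by move=> [a b] [a' b'] /mcat_inj /= [/val_inj -> /val_inj ->].
rewrite /logsum (@big_bmnm _ m.+1 _ _ e
  (fun x => mdeg x.1 + mdeg x.2 + (mdeg c + mdeg d) == m)%N
  (fun u => mdeg u + mdeg (mcat s c d) == m)%N
  (fun u => h (u + mcat s c d)%MM * hasse u Q)) //; first last.
- by move=> [a b]; rewrite !mdeg_cat.
- move=> u; rewrite -(mcatK s u) !mdeg_cat => /eqP du.
  have lta : (mdeg (mpl s u) < m.+1)%N by lia.
  have ltb : (mdeg (mpr s u) < m.+1)%N by lia.
  by exists (BMultinom lta, BMultinom ltb) => //=; apply/eqP; lia.
- by move=> u /eqP; lia.
rewrite big_mkcond /= -(pair_bigA _ (fun (a : 'X_{1..p < m.+1})
  (b : 'X_{1..q < m.+1}) => if (mdeg a + mdeg b + (mdeg c + mdeg d) == m)%N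
  then h (mcat s a b + mcat s c d)%MM * hasse (mcat s a b) Q else 0)) /=.
rewrite exchange_big [RHS]big_mkcond /=; apply: eq_bigr => b _.
case: leqP => [le|lt]; last first.
  by rewrite big1 // => a _; rewrite ifF //; apply/eqP; lia.
have -> : elogsum s (m - (mdeg b + mdeg d)) Q1
      (fun a => h (mcat s a (b + d)%MM)) c =
    \sum_(a : 'X_{1..p < m.+1} | (mdeg a + mdeg c == m - (mdeg b + mdeg d))%N)
      h (mcat s (a + c)%MM (b + d)%MM) * inl (hasse a Q1).
  apply: (@big_bmnm _ _ _ _ (@bmnm p m.+1)
    (fun a => mdeg a + mdeg c == m - (mdeg b + mdeg d))%N
    (fun a => mdeg a + mdeg c == m - (mdeg b + mdeg d))%N
    (fun a => h (mcat s (a + c) (b + d))%MM * inl (hasse a Q1))) => //.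
  - exact: val_inj.
  - by move=> u /eqP; lia.
  move=> u /eqP du; have ltu : (mdeg u < m.+1)%N by lia.
  by exists (BMultinom ltu) => //=; apply/eqP.
rewrite [RHS]mulr_sumr [RHS]big_mkcond /=; apply: eq_bigr => a _.
have -> : (mdeg a + mdeg b + (mdeg c + mdeg d) == m)%N =
    (mdeg a + mdeg c == m - (mdeg b + mdeg d))%N by apply/eqP/eqP; lia.
case: ifP => // _.
by rewrite -mcatD (hasse_minj s charK) mulrA mulrC.
Qed.

(** Induction on [m - mdeg b]. In the condition at [(c, b)], the term that does not derive [Q2] is
    [Q2] times the wanted sum; the others concern indices [b' + b] of larger degree. Finally [Q2]
    cancels modulo [Q1]. *)
Lemma elogcoef_logcoef m h b : Q2 != 0 -> logcoef m Q h -> (mdeg b <= m)%N ->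
  elogcoef s (m - mdeg b) Q1 (fun a => h (mcat s a b)).
Proof.
move=> nzQ2 hh; have [k] := ubnP (m - mdeg b); elim: k b => // k IHk b ltk leb c.
have : mdvd (inl Q1) (logsum m Q h (mcat s c b)).
  by have [w ->] := hh (mcat s c b); exists (inr Q2 * w); rewrite mulrA.
rewrite logsum_cat (bigD1 bm0) /=; last by rewrite mdeg0.
rewrite mdeg0 add0n add0m hasse0m; set X := (X in _ + X) => hX.
apply: (mdvd_minj_cancel (s := swap s) nzQ2).
rewrite -[mdvd _ _]/(mdvd (inl Q1) _) -[_ * _](addrK X); apply: mdvdB hX _.
apply: mdvd_sum => b' /andP[le]; rewrite bmeqP /= => nz; apply: mdvdMl.
have lt0 : (0 < mdeg b')%N by rewrite lt0n mdeg_eq0.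
have dE : mdeg (b' + b)%MM = (mdeg b' + mdeg b)%N by rewrite mdegD.
by have := IHk (b' + b)%MM; rewrite dE; apply; lia.
Qed.

(** The product of an operator in [x] of order [i] and an operator in [y], extended by zero to the
    other blocks. Testing the degree in [x] is enough, as the total order fixes the degree in
    [y]. *)
Definition tens i (u : 'X_{1..p} -> {mpoly K[p]}) (v : 'X_{1..q} -> {mpoly K[q]})
    (w : 'X_{1..n}) : S :=
  if mdeg (mpl s w) == i then inl (u (mpl s w)) * inr (v (mpr s w)) else 0.

Lemma tensE i u v a b : mdeg a = i ->
  tens i u v (mcat s a b) = inl (u a) * inr (v b).
Proof. by rewrite /tens mcatKl mcatKr => ->; rewrite eqxx. Qed.

Lemma tens_eq0 i u v a b : mdeg a != i -> tens i u v (mcat s a b) = 0.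
Proof. by rewrite /tens mcatKl => /negbTE ->. Qed.

(** The iterated commutators of a product of operators in disjoint variables are products, so
    [logsum] factors. *)
Lemma logcoef_tens m i u v : (i <= m)%N ->
  logcoef i Q1 u -> logcoef (m - i) Q2 v -> logcoef m Q (tens i u v).
Proof.
move=> lei hu hv w; rewrite -(mcatK s w); move: (mpl s w) (mpr s w) => c d.
suff -> : logsum m Q (tens i u v) (mcat s c d) =
    inl (logsum i Q1 u c) * inr (logsum (m - i) Q2 v d).
  have [x ->] := hu c; have [y ->] := hv d; exists (inl x * inr y).
  by rewrite !minjM mulrACA.
have inlE : inl (logsum i Q1 u c) =
    \sum_(a : 'X_{1..p < i.+1} | (mdeg a + mdeg c == i)%N)
      inl (u (a + c)%MM) * inl (hasse a Q1).
  by rewrite /logsum (rmorph_sum (minj s)); apply: eq_bigr => a _; apply: minjM.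
have inrE : inr (logsum (m - i) Q2 v d) =
    \sum_(b : 'X_{1..q < m.+1} | (mdeg b + mdeg d == m - i)%N)
      inr (v (b + d)%MM) * inr (hasse b Q2).
  rewrite /logsum (rmorph_sum (minj (swap s))) /=.
  rewrite (eq_bigr (fun b : 'X_{1..q < (m - i).+1} =>
    inr (v (b + d)%MM) * inr (hasse b Q2))); last by move=> b _; apply: minjM.
  rewrite (@big_bmnm _ _ _ _ (@bmnm q m.+1)
    (fun b => mdeg b + mdeg d == m - i)%N
    (fun b => mdeg b + mdeg d == m - i)%N
    (fun b => inr (v (b + d)%MM) * inr (hasse b Q2))) //.
  - exact: val_inj.
  - by move=> b /eqP; lia.
  move=> b /eqP db; have ltb : (mdeg b < m.+1)%N by lia.
  by exists (BMultinom ltb) => //=; apply/eqP.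
rewrite logsum_cat inrE mulr_sumr big_mkcond [RHS]big_mkcond /=.
apply: eq_bigr => b _; case: leqP => [le|lt]; last first.
  by rewrite ifF //; apply/eqP; lia.
case: eqP => [di|ndi].
  have -> : (m - (mdeg b + mdeg d))%N = i by lia.
  rewrite [inr (v _) * _]mulrC mulrCA; congr (_ * _).
  rewrite inlE mulr_suml; apply: eq_bigr => a /eqP da.
  by rewrite tensE ?mdegD // mulrAC.
rewrite /elogsum big1 ?mulr0 // => a /eqP da.
by rewrite tens_eq0 ?mul0r // mdegD; apply/eqP; lia.
Qed.

End Product.

(** * Logarithmic operators of a product *)

Section ProductBasis.
Variables (K : fieldType) (p q n : nat) (s : splitting p q n).
Hypothesis charK : [pchar K] =i pred0.
Local Notation S := {mpoly K[n]}.
Local Notation inl := (@minj K _ _ _ s).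
Local Notation inr := (@minj K _ _ _ (swap s)).
Variables (Q1 : {mpoly K[p]}) (Q2 : {mpoly K[q]}).
Hypotheses (nzQ1 : Q1 != 0) (nzQ2 : Q2 != 0).
Local Notation Q := (inl Q1 * inr Q2).

Lemma logcoef_swap m h :
  logcoef m Q h -> logcoef m (minj (swap s) Q2 * minj (swap (swap s)) Q1) h.
Proof. by rewrite mulrC. Qed.

(** Expand the block over the basis of [Q1] with scalars extended. The coefficients satisfy the
    conditions of [Q2], and are expanded in turn over the basis of [Q2]. *)
Lemma logcoef_span_tens (T1 T2 : finType) m i (g1 : T1 -> 'X_{1..p} -> {mpoly K[p]})
    (g2 : T2 -> 'X_{1..q} -> {mpoly K[q]}) (h : 'X_{1..n} -> S) :
  (i <= m)%N -> islogbasis i Q1 g1 -> islogbasis (m - i) Q2 g2 ->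
  logcoef m Q h ->
  exists c : T1 * T2 -> S, forall a b, mdeg a = i -> mdeg b = (m - i)%N ->
    h (mcat s a b) = \sum_t c t * (inl (g1 t.1 a) * inr (g2 t.2 b)).
Proof.
move=> lei B1 B2 hh.
have E1 (b : 'X_{1..q < (m - i).+1}) : exists c : T1 -> S,
    mdeg b = (m - i)%N -> forall a, mdeg a = i ->
      h (mcat s a b) = \sum_t c t * inl (g1 t a).
  have [db|ne] := eqVneq (mdeg b) (m - i)%N; last first.
    by exists (fun=> 0) => /eqP; rewrite (negbTE ne).
  have := elogcoef_logcoef charK (b := b) nzQ2 hh; rewrite {1 2}db subKn //.
  move=> /(_ (leq_subr _ _))/(logbasis_span_ext B1)[c hc].
  by exists c => _.
have [C hC] := fin_all_exists E1.
(* The default [bm0] is never met at the degree [m - i]. *)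
pose D t (b : 'X_{1..q}) := C (insubd bm0 b) t.
have hD a b : mdeg a = i -> mdeg b = (m - i)%N ->
    h (mcat s a b) = \sum_t D t b * inl (g1 t a).
  move=> da db; have ltb : (mdeg b < (m - i).+1)%N by rewrite db.
  have bE : insubd bm0 b = BMultinom ltb :> 'X_{1..q < (m - i).+1}.
    by apply: val_inj; rewrite val_insubd ltb.
  by rewrite /D bE -hC.
(* The conditions of [Q2] hold for the combinations with coefficients [g1 t a]; [logbasis_cancel]
   passes them to the individual coefficients. *)
have DD t : elogcoef (swap s) (m - i) Q2 (D t).
  move=> d; move: t.
  apply: (logbasis_cancel B1 (z := fun t => elogsum (swap s) (m - i) Q2 (D t) d) nzQ1) => a da.
  have := elogcoef_logcoef charK (b := a) nzQ1 (logcoef_swap hh).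
  rewrite da => /(_ lei d); congr mdvd; rewrite /elogsum.
  under [RHS]eq_bigr do rewrite mulr_sumr.
  rewrite exchange_big /=; apply: eq_bigr => b /eqP db.
  rewrite -[h _]/(h (mcat s a (b + d)%MM)) hD // ?mdegD // mulr_suml.
  by apply: eq_bigr => t _; rewrite mulrAC mulrC mulrA.
have [E hE] := fin_all_exists (fun t => logbasis_span_ext B2 (DD t)).
exists (fun t => E t.1 t.2) => a b da db; rewrite hD //.
rewrite -(pair_bigA _ (fun t1 t2 => E t1 t2 * (inl (g1 t1 a) * inr (g2 t2 b)))) /=.
apply: eq_bigr => t _; rewrite hE // mulr_suml; apply: eq_bigr => t' _.
by rewrite mulrAC mulrA.
Qed.

Lemma tens_free (T1 T2 : finType) i j (g1 : T1 -> 'X_{1..p} -> {mpoly K[p]})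
    (g2 : T2 -> 'X_{1..q} -> {mpoly K[q]}) (c : T1 * T2 -> S) :
  islogbasis i Q1 g1 -> islogbasis j Q2 g2 ->
  (forall a b, mdeg a = i -> mdeg b = j ->
    \sum_t c t * (inl (g1 t.1 a) * inr (g2 t.2 b)) = 0) ->
  forall t, c t = 0.
Proof.
move=> B1 B2 h [t1 t2]; have inner b : mdeg b = j ->
    forall t, \sum_t' c (t, t') * inr (g2 t' b) = 0.
  move=> db; apply: (logbasis_free_ext B1) => a da; rewrite -[RHS](h a b da db).
  rewrite (eq_bigr (fun t => c (t.1, t.2) * (inl (g1 t.1 a) * inr (g2 t.2 b))));
    last by case.
  rewrite -(pair_bigA _ (fun t1 t2 =>
    c (t1, t2) * (inl (g1 t1 a) * inr (g2 t2 b)))) /=.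
  apply: eq_bigr => t _; rewrite mulr_suml; apply: eq_bigr => t' _.
  by rewrite mulrAC mulrA.
by apply: (logbasis_free_ext B2 (c := fun t' => c (t1, t'))) => b db; apply: inner.
Qed.

Variables (n1 n2 : nat -> nat).
Variable g1 : forall i, 'I_(n1 i) -> 'X_{1..p} -> {mpoly K[p]}.
Variable g2 : forall i, 'I_(n2 i) -> 'X_{1..q} -> {mpoly K[q]}.

Definition tens_index m : finType :=
  {i : 'I_m.+1 & ('I_(n1 i) * 'I_(n2 (m - i)))%type}.

Definition tens_basis m (t : tens_index m) : 'X_{1..n} -> S :=
  tens s (tag t) (g1 (tagged t).1) (g2 (tagged t).2).

Lemma sum_tens_basis m (c : tens_index m -> S) (i : 'I_m.+1) a b : mdeg a = i ->
  \sum_t c t * tens_basis t (mcat s a b) =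
  \sum_(t : 'I_(n1 i) * 'I_(n2 (m - i)))
    c (Tagged _ t) * (inl (g1 t.1 a) * inr (g2 t.2 b)).
Proof.
move=> da.
transitivity (\sum_(k < m.+1) \sum_(t : 'I_(n1 k) * 'I_(n2 (m - k)))
    c (Tagged _ t) * tens s k (g1 t.1) (g2 t.2) (mcat s a b)).
  by rewrite sig_big_dep; apply: eq_bigr => -[k t].
rewrite (bigD1 i) //= [X in _ + X]big1 ?addr0 => [|k ne].
  by apply: eq_bigr => t _; rewrite tensE.
rewrite big1 // => t _; rewrite tens_eq0 ?mulr0 // da.
by apply: contra_neq ne => /val_inj.
Qed.

(** The tensors attached to [i] are supported on the block of bidegree [(i, m - i)], so spanning and
    freeness are checked block by block. *)
Lemma islogbasis_tens m :
  (forall i, (i <= m)%N -> islogbasis i Q1 (@g1 i) /\ islogbasis i Q2 (@g2 i)) ->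
  islogbasis m Q (@tens_basis m).
Proof.
move=> B; have le (i : 'I_m.+1) : (i <= m)%N by rewrite -ltnS.
split=> [[i [j k]]|h hh|c hc].
- have [[D1 _ _] _] := B i (le i); have [_ [D2 _ _]] := B _ (leq_subr i m).
  exact: logcoef_tens.
- have [c hc] := fin_all_exists (fun i : 'I_m.+1 => logcoef_span_tens (le i)
    (B i (le i)).1 (B _ (leq_subr i m)).2 hh).
  exists (fun t => c (tag t) (tagged t)) => w dw.
  have dE : (mdeg (mpl s w) + mdeg (mpr s w) = m)%N by rewrite -(mdeg_cat s) mcatK.
  have lti : (mdeg (mpl s w) < m.+1)%N by lia.
  rewrite -(mcatK s w) (sum_tens_basis _ (i := Ordinal lti)) //.
  by rewrite (hc (Ordinal lti)) //=; lia.
move=> [i t]; have [B1 _] := B i (le i); have [_ B2] := B _ (leq_subr i m).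
apply: (tens_free (c := fun t => c (Tagged _ t)) B1 B2) => a b da db.
rewrite -(sum_tens_basis _ _ da); apply: hc.
by rewrite mdeg_cat da db subnKC.
Qed.

End ProductBasis.

Section CoefficientRows.
Variables (K : fieldType) (l m : nat).

Definition mindices : {pred 'X_{1..l < m.+1}} :=
  [pred a : 'X_{1..l < m.+1} | mdeg a == m].

Definition mindex (k : 'I_#|mindices|) : 'X_{1..l < m.+1} := enum_val k.

Lemma mdeg_mindex k : mdeg (mindex k) = m.
Proof. exact/eqP/(enum_valP k). Qed.

(** Turns operators into row vectors, to which the results on graded submodules of a free module
    apply. *)
Definition coefrow (g : 'X_{1..l} -> {mpoly K[l]}) :
  'rV[{mpoly K[l]}]_#|mindices| := \row_k g (mindex k).

Lemma eq_coefrow (g h : 'X_{1..l} -> {mpoly K[l]}) :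
  coefrow g = coefrow h <-> forall a, mdeg a = m -> g a = h a.
Proof.
split=> [e a da|e]; last first.
  by apply/rowP => k; rewrite !mxE e ?mdeg_mindex.
have lta : (mdeg a < m.+1)%N by rewrite da.
have aP : BMultinom lta \in mindices by apply/eqP.
have /rowP/(_ (enum_rank_in aP (BMultinom lta))) := e.
by rewrite !mxE /mindex !enum_rankK_in.
Qed.

Lemma coefrow_sum k (c : 'rV_k) (g : 'I_k -> 'X_{1..l} -> {mpoly K[l]}) V :
  (forall t, row t V = coefrow (g t)) ->
  coefrow (fun a => \sum_t c 0 t * g t a) = c *m V.
Proof.
move=> hV; apply/rowP => a; rewrite !mxE; apply: eq_bigr => t _.
by have /rowP/(_ a) := hV t; rewrite !mxE => ->.
Qed.

End CoefficientRows.

(** * Descent from the product to a factor *)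

Section Factor.
Variables (K : fieldType) (p q n : nat) (s : splitting p q n).
Hypothesis charK : [pchar K] =i pred0.
Local Notation S := {mpoly K[n]}.
Local Notation inl := (@minj K _ _ _ s).
Local Notation inr := (@minj K _ _ _ (swap s)).
Local Notation yc := (@ycoef K _ _ _ s).
Variables (Q1 : {mpoly K[p]}) (Q2 : {mpoly K[q]}) (d1 : nat).
Hypotheses (nzQ1 : Q1 != 0) (nzQ2 : Q2 != 0) (hQ1 : Q1 \is d1.-homog).
Hypothesis q_gt0 : (0 < q)%N.
Local Notation Q := (inl Q1 * inr Q2).

(** Classical, since [P] is not assumed decidable. *)
Lemma exists_min_nat (P : nat -> Prop) :
  (exists k, P k) -> exists2 k, P k & forall j, P j -> (k <= j)%N.
Proof.
move=> [k]; elim/ltn_ind: k => k IHk Pk.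
have [[j ltjk Pj]|no] := classic (exists2 j, (j < k)%N & P j).
  exact: IHk ltjk Pj.
exists k => // j Pj; rewrite leqNgt; apply/negP => ltjk.
by apply: no; exists j.
Qed.

(* A monomial of minimal degree in y occurring in an operator of Q2: its
   coefficient in an operator of the product is linear modulo (y). *)
Lemma exists_min_coef j : exists (v : 'X_{1..q} -> {mpoly K[q]}) b e,
  [/\ logcoef j Q2 v, mdeg b = j, (v b)@_e = 1 &
      forall w b' e', logcoef j Q2 w -> mdeg b' = j -> (w b')@_e' != 0 ->
        (mdeg e <= mdeg e')%N].
Proof.
pose P k := exists (v : 'X_{1..q} -> {mpoly K[q]}) b e,
  [/\ logcoef j Q2 v, mdeg b = j, (v b)@_e != 0 & mdeg e = k].
have [|_ [v [b [e [hv db nz <-]]]] min] := @exists_min_nat P.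
  (* The constant family [Q2] is logarithmic, and [q_gt0] provides an index of degree [j] at which
     to read it. *)
  exists (mdeg (mlead Q2)), (fun=> Q2), (U_(Ordinal q_gt0) *+ j)%MM, (mlead Q2).
  split=> //; first by apply: logcoef_mdvd => _; apply: mdvd_refl.
    by rewrite mdegMn mdeg1 mul1n.
  by rewrite mleadc_eq0.
exists (fun a => (((v b)@_e)^-1)%:MP * v a), b, e; split=> //.
- exact: logcoefM.
- by rewrite mcoeffCM mulVf.
by move=> w b' e' hw db' nz'; apply: min; exists w, b', e'.
Qed.

(* The operators of Q1 of order i are a direct summand of those of the product
   modulo (y), hence graded and projective. *)
Lemma islogbasis_factor m i N (G : 'I_N -> 'X_{1..n} -> S) :
  (i <= m)%N -> islogbasis m Q G ->
  exists n1 (g1 : 'I_n1 -> 'X_{1..p} -> {mpoly K[p]}), islogbasis i Q1 g1.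
Proof.
move=> lei [GD GS GF].
have [v [b [e [vD db ve1 min]]]] := exists_min_coef (m - i).
(* [phi] reads the coefficient of [y^e] at the index [b]; tensoring with [v] is a section of it
   because [(v b)@_e = 1]. *)
pose phi (h : 'X_{1..n} -> S) (a : 'X_{1..p}) := yc e (h (mcat s a b)).
have phiD h : logcoef m Q h -> logcoef i Q1 (phi h).
  move=> hh; have := elogcoef_logcoef charK (b := b) nzQ2 hh.
  by rewrite db subKn // => /(_ (leq_subr _ _))/elogcoefP; apply.
(* For each monomial in [x], the coefficients of [h] form an operator of [Q2], to which the
   minimality of [e] applies. *)
have low h a e' : logcoef m Q h -> mdeg a = i -> (mdeg e' < mdeg e)%N ->
    yc e' (h (mcat s a b)) = 0.
  move=> hh da lte; apply/mpolyP => x; rewrite mcoeff_ycoef mcoeff0.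
  have := elogcoef_logcoef charK (b := a) nzQ1 (logcoef_swap hh).
  rewrite da => /(_ lei)/elogcoefP/(_ x) hw.
  apply: contraTeq lte => nz; rewrite -leqNgt; apply: (min _ b e' hw db).
  by rewrite mcoeff_ycoef.
have psiD g : logcoef i Q1 g -> logcoef m Q (tens s i g v).
  by move=> hg; apply: logcoef_tens.
have phi_psi g a : mdeg a = i -> phi (tens s i g v) a = g a.
  by move=> da; rewrite /phi tensE // ycoefMinj ve1 mpolyC1 mulr1.
have phi_sum (c : 'I_N -> S) a : mdeg a = i ->
    yc e (\sum_t c t * G t (mcat s a b)) =
    \sum_t yc 0%MM (c t) * phi (G t) a.
  move=> da; rewrite ycoef_sum; apply: eq_bigr => t _.
  by apply: ycoef_mul_low => e' lte; apply: low.
have coords g : logcoef i Q1 g -> exists c : 'I_N -> S,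
    forall w, mdeg w = m -> tens s i g v w = \sum_t c t * G t w.
  by move=> /psiD/GS.
have degw a : mdeg a = i -> mdeg (mcat s a b) = m.
  by move=> da; rewrite mdeg_cat da db subnKC.
have coordsE g c a : (forall w, mdeg w = m -> tens s i g v w = \sum_t c t * G t w) ->
    mdeg a = i -> g a = \sum_t yc 0%MM (c t) * phi (G t) a.
  by move=> hc da; rewrite -phi_sum // -hc ?degw // -[LHS](phi_psi _ _ da).
pose Nm u := exists2 g, logcoef i Q1 g & u = coefrow i g.
pose V := \matrix_(t < N) coefrow i (phi (G t)).
have VE t : row t V = coefrow i (phi (G t)) by rewrite rowK.
have NmV t : Nm (row t V) by exists (phi (G t)); [apply/phiD/GD | rewrite rowK].
have genV : generates Nm V.
  split=> // _ [g hg ->]; have [c hc] := coords g hg.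
  exists (\row_t yc 0%MM (c t)); rewrite -(coefrow_sum _ VE).
  apply/eq_coefrow => a da; rewrite (coordsE g c) //.
  by apply: eq_bigr => t _; rewrite mxE.
have [C hC] := fin_all_exists (fun t => coords _ (phiD _ (GD t))).
(* Row [t] holds the coordinates, taken at [y = 0], of the tensor of [phi (G t)] with [v]. *)
pose E : 'M_N := \matrix_(t, t') yc 0%MM (C t t').
have splitV : splits V E.
  split.
    apply/row_matrixP => t; rewrite row_mul -(coefrow_sum _ VE) VE.
    apply/eq_coefrow => a da; rewrite (coordsE _ _ _ (hC t) da).
    by apply: eq_bigr => t' _; rewrite !mxE.
  move=> x; rewrite -(coefrow_sum _ VE) => x0; apply/rowP => t'; rewrite !mxE.
  (* A relation between the [phi (G t)] persists after tensoring with [v], and freeness of [G] then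
     kills its coordinates; set [y = 0]. *)
  suff /(_ t')/(congr1 (yc 0%MM)) : forall t', \sum_t inl (x 0 t) * C t t' = 0.
    rewrite ycoef0 ycoef_sum; apply: etrans; apply: eq_bigr => t _.
    by rewrite ycoefMl mxE.
  apply: (GF (fun t' => \sum_t inl (x 0 t) * C t t')).
  move=> w dw; under eq_bigr do rewrite mulr_suml.
  rewrite exchange_big /=.
  have x0' a : mdeg a = i -> \sum_t x 0 t * phi (G t) a = 0.
    move=> da; have e0 : coefrow i (fun a => \sum_t x 0 t * phi (G t) a) =
        coefrow i (fun=> 0) by rewrite x0; apply/rowP => k; rewrite !mxE.
    by move/eq_coefrow: e0; apply.
  transitivity (\sum_t inl (x 0 t) * tens s i (phi (G t)) v w).
    by apply: eq_bigr => t _; rewrite hC // mulr_sumr; apply: eq_bigr => t'' _; rewrite mulrA.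
  have [da|ne] := eqVneq (mdeg (mpl s w)) i; last first.
    by rewrite big1 // => t _; rewrite -(mcatK s w) tens_eq0 ?mulr0.
  rewrite -(mcatK s w); under eq_bigr do rewrite tensE // mulrA -minjM.
  by rewrite -mulr_suml -(rmorph_sum (minj s)) x0' // raddf0 mul0r.
have Nmpi d u : Nm u -> Nm (map_mx (pihomog mdeg d) u).
  move=> [g hg ->]; exists (fun a => pihomog mdeg d (g a)).
    exact: logcoef_pihomog hQ1 hg.
  by apply/rowP => k; rewrite !mxE.
have [n1 [v' [[Nv' gv'] fv']]] := free_of_split Nmpi genV splitV.
have Nv'' t : exists g, logcoef i Q1 g /\ row t v' = coefrow i g.
  by have [g] := Nv' t; exists g.
have [g1 hg1] := fin_all_exists Nv''.
have v'E t := (hg1 t).2.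
exists n1, g1; split=> [t|h hh|c hc t]; first exact: (hg1 t).1.
  have [|c] := gv' (coefrow i h); first by exists h.
  rewrite -(coefrow_sum _ v'E) => /eq_coefrow hc.
  by exists (fun t => c 0 t).
suff /rowP/(_ t) : \row_t c t = 0 by rewrite !mxE.
apply: fv'; rewrite -(coefrow_sum _ v'E); apply/rowP => k; rewrite !mxE.
rewrite -[RHS](hc _ (mdeg_mindex k)).
by apply: eq_bigr => t' _; rewrite mxE.
Qed.

End Factor.

(** * Products of arrangements *)

Section DirectSumSplitting.
Variables l1 l2 : nat.

Definition sum_mcat (a : 'X_{1..l1}) (b : 'X_{1..l2}) : 'X_{1..l1 + l2} :=
  [multinom match split i with inl j => a j | inr k => b k end | i < l1 + l2].

Lemma sum_mcatl a b i : sum_mcat a b (lshift l2 i) = a i.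
Proof. by rewrite mnmE -[lshift l2 i]/(unsplit (inl _)) unsplitK. Qed.

Lemma sum_mcatr a b i : sum_mcat a b (rshift l1 i) = b i.
Proof. by rewrite mnmE -[rshift l1 i]/(unsplit (inr _)) unsplitK. Qed.

Definition sum_mcatE := (sum_mcatl, sum_mcatr).

Definition sum_splitting : splitting l1 l2 (l1 + l2).
Proof.
apply: (@Splitting l1 l2 (l1 + l2) sum_mcat
  (fun u => [multinom u (lshift l2 i) | i < l1])
  (fun u => [multinom u (rshift l1 i) | i < l2])).
- by move=> a b; apply/mnmP => i; rewrite mnmE sum_mcatE.
- by move=> a b; apply/mnmP => i; rewrite mnmE sum_mcatE.
- by move=> u; apply/mnmP => i; case: (split_ordP i) => j ->; rewrite sum_mcatE mnmE.
- move=> a b a' b'; apply/mnmP => i.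
  by case: (split_ordP i) => j ->; rewrite mnmDE !sum_mcatE mnmDE.
- move=> a b; rewrite !mdegE big_split_ord /=.
  by congr (_ + _)%N; apply: eq_bigr => i _; rewrite sum_mcatE.
move=> u v a b; rewrite /mbinom big_split_ord /=.
by congr (_ * _)%N; apply: eq_bigr => i _; rewrite !sum_mcatE.
Defined.

Variable K : fieldType.
Notation s := sum_splitting.

Lemma minj_XUl i : minj s 'X_i = 'X_(lshift l2 i) :> {mpoly K[l1 + l2]}.
Proof.
rewrite minjX; congr mpolyX; apply/mnmP => k /=.
case: (split_ordP k) => j ->; rewrite sum_mcatE !mnm1E; first by rewrite eq_lshift.
by rewrite mnm0E eq_lrshift.
Qed.

Lemma minj_XUr i : minj (swap s) 'X_i = 'X_(rshift l1 i) :> {mpoly K[l1 + l2]}.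
Proof.
rewrite minjX; congr mpolyX; apply/mnmP => k /=.
case: (split_ordP k) => j ->; rewrite sum_mcatE !mnm1E; last by rewrite eq_rshift.
by rewrite mnm0E eq_rlshift.
Qed.

End DirectSumSplitting.

Opaque sum_splitting.

(** * Linear forms and defining polynomials *)

Section LinearForms.
Variables (K : fieldType) (V : vectType K).

(** Off the common kernel choose [w]: every vector is a multiple of [w] modulo that kernel, so the
    ratio of the two values at [w] is the constant. *)
Lemma proportional_forms (a b : 'Hom(V, K^o)) : lker a = lker b -> b != 0 ->
  exists2 c : K, c != 0 & forall u, a u = c * b u.
Proof.
move=> kE nzb; have [w bw] : exists w, b w != 0.
  have [/existsP[i bi]|/existsPn h] := boolP [exists i, b (tnth (vbasis {:V}) i) != 0].
    by exists (tnth (vbasis {:V}) i).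
  case/eqP: nzb; apply/lfunP => u; rewrite lfunE /=.
  rewrite (coord_basis (vbasisP {:V}) (memvf u)) linear_sum big1 // => i _.
  by rewrite linearZ /= -tnth_nth; have /negPn/eqP -> := h i; rewrite scaler0.
have aw : a w != 0 by rewrite -memv_ker kE memv_ker.
exists (a w / b w) => [|u]; first by rewrite mulf_neq0 ?invr_neq0.
have : u - (b u / b w) *: w \in lker a.
  rewrite kE memv_ker linearB linearZ /=.
  by rewrite -[_ *: b w]/(b u / b w * b w) mulfVK // subrr.
rewrite memv_ker linearB linearZ subr_eq0 => /eqP -> /=.
by rewrite -[LHS]/(b u / b w * a w) mulrC mulrA mulrAC.
Qed.

Lemma hyperplane_neq (H : {vspace V}) : (\dim H).+1 = \dim {:V} -> H != {:V}%VS.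
Proof. by move=> dH; apply: contra_eq_neq dH => ->; lia. Qed.

Lemma alpha_neq0 (H : {vspace V}) : (\dim H).+1 = \dim {:V} -> alpha H != 0.
Proof.
move=> dH; have := hyperplane_neq dH; rewrite -{1}(lker_alpha dH).
by apply: contra_neq => ->; apply/vspaceP => u; rewrite memv_ker lfunE eqxx memvf.
Qed.

Variables (l : nat) (v : l.-tuple V).

Lemma form_poly_homog (a : 'Hom(V, K^o)) : form_poly v a \is 1.-homog.
Proof.
apply: rpred_sum => i _; apply: dhomogZ.
by rewrite dhomogX -[_ U_(i)%MM]/(mdeg U_(i)%MM) mdeg1.
Qed.

Lemma defpoly_homog A : exists d, defpoly v A \is d.-homog.
Proof.
rewrite /defpoly; elim: (enum_fset A) => [|H r [d IHr]].
  by exists 0%N; rewrite big_nil dhomog1.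
by exists (1 + d)%N; rewrite big_cons dhomogM ?form_poly_homog.
Qed.

Hypothesis hv : basis_of {:V} v.

Lemma form_poly_neq0 (a : 'Hom(V, K^o)) : a != 0 -> form_poly v a != 0.
Proof.
apply: contra_neq => f0; apply/lfunP => u; rewrite lfunE /=.
rewrite (coord_basis hv (memvf u)) linear_sum big1 // => i _.
rewrite linearZ /= -tnth_nth.
suff -> : a (tnth v i) = 0 by rewrite scaler0.
have := congr1 (mcoeff U_(i)) f0; rewrite mcoeff0 linear_sum /=.
rewrite (bigD1 i) //= mcoeffZ mcoeffXU eqxx mulr1 big1 ?addr0 // => j ne.
by rewrite mcoeffZ mcoeffXU (negbTE ne) mulr0.
Qed.

Lemma defpoly_neq0 A : arrangement A -> defpoly v A != 0.
Proof.
move=> hA; rewrite /defpoly prodf_seq_neq0; apply/allP => H HA /=.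
exact/form_poly_neq0/alpha_neq0/hA.
Qed.

End LinearForms.

Section ProductPolynomial.
Variables (K : fieldType) (V1 V2 : vectType K) (l1 l2 : nat).
Variables (v1 : l1.-tuple V1) (v2 : l2.-tuple V2).
Local Notation s := (sum_splitting l1 l2).
Local Notation v := (prod_basis v1 v2).

Lemma mem_dsum (U1 : {vspace V1}) (U2 : {vspace V2}) u :
  (u \in dsum U1 U2) = (u.1 \in U1) && (u.2 \in U2).
Proof. by rewrite memv_cap -!memv_preim !lfunE. Qed.

Lemma form_poly_prodl (a : 'Hom((V1 * V2)%type, K^o)) (a1 : 'Hom(V1, K^o)) (c : K) :
  (forall u, a u = c * a1 u.1) ->
  form_poly v a = c *: minj s (form_poly v1 a1).
Proof.
move=> aE; rewrite /form_poly big_split_ord /= [X in _ + X]big1 => [|i _].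
  rewrite addr0 (rmorph_sum (minj s)) scaler_sumr; apply: eq_bigr => i _ /=.
  rewrite minjZ minj_XUl aE scalerA !(tnth_nth 0) /= nth_cat size_map size_tuple.
  rewrite ltn_ord (nth_map 0) ?size_tuple //.
rewrite aE (tnth_nth 0) /= nth_cat size_map size_tuple ltnNge leq_addr /=.
by rewrite addKn (nth_map 0) ?size_tuple //= linear0 mulr0 scale0r.
Qed.

Lemma form_poly_prodr (a : 'Hom((V1 * V2)%type, K^o)) (a2 : 'Hom(V2, K^o)) (c : K) :
  (forall u, a u = c * a2 u.2) ->
  form_poly v a = c *: minj (swap s) (form_poly v2 a2).
Proof.
move=> aE; rewrite /form_poly big_split_ord /= [X in X + _]big1 => [|i _].
  rewrite add0r (rmorph_sum (minj (swap s))) scaler_sumr; apply: eq_bigr => i _ /=.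
  rewrite minjZ minj_XUr aE scalerA !(tnth_nth 0) /= nth_cat size_map size_tuple.
  by rewrite ltnNge leq_addr /= addKn (nth_map 0) ?size_tuple.
rewrite aE (tnth_nth 0) /= nth_cat size_map size_tuple ltn_ord.
by rewrite (nth_map 0) ?size_tuple //= linear0 mulr0 scale0r.
Qed.

Lemma dim_lker_form (V : vectType K) (a : 'Hom(V, K^o)) : a != 0 ->
  (\dim (lker a)).+1 = \dim {:V}.
Proof.
move=> nz; rewrite -(limg_ker_dim a fullv) capfv -addn1; congr (_ + _)%N.
apply/eqP; rewrite eq_sym eqn_leq; apply/andP; split.
  by rewrite (leq_trans (dimvS (subvf _))) // dimvf.
rewrite lt0n dimv_eq0; apply: contra nz => /eqP im0; apply/eqP/lfunP => u.
by apply/eqP; rewrite [X in _ == X]lfunE /= -memv0 -im0 memv_img ?memvf.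
Qed.

(** [alpha H] is an arbitrary choice of form, known only up to a nonzero scalar. *)
Lemma alpha_proportional (V : vectType K) (H : {vspace V}) (b : 'Hom(V, K^o)) :
  b != 0 -> lker b = H -> exists2 c : K, c != 0 & forall u, alpha H u = c * b u.
Proof.
move=> nzb kb; have dH := dim_lker_form nzb; rewrite kb in dH.
by apply: proportional_forms nzb; rewrite lker_alpha.
Qed.

Lemma alpha_dsuml (H : {vspace V1}) : (\dim H).+1 = \dim {:V1} ->
  exists2 c : K, c != 0 & form_poly v (alpha (dsum H {:V2})) =
    c *: minj s (form_poly v1 (alpha H)).
Proof.
move=> dH; pose b : 'Hom((V1 * V2)%type, K^o) := (alpha H \o linfun (@fst V1 V2))%VF.
have bE u : b u = alpha H u.1 by rewrite comp_lfunE lfunE.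
have nzb : b != 0.
  apply/eqP => /lfunP b0; case/eqP: (alpha_neq0 dH); apply/lfunP => u.
  by have := b0 (u, 0); rewrite bE !lfunE.
have kb : lker b = dsum H {:V2}.
  apply/vspaceP => u; rewrite memv_ker bE mem_dsum memvf andbT.
  by rewrite -memv_ker lker_alpha.
have [c nzc cE] := alpha_proportional nzb kb.
exists c => //; apply: form_poly_prodl => u.
by rewrite cE bE.
Qed.

Lemma alpha_dsumr (H : {vspace V2}) : (\dim H).+1 = \dim {:V2} ->
  exists2 c : K, c != 0 & form_poly v (alpha (dsum {:V1} H)) =
    c *: minj (swap s) (form_poly v2 (alpha H)).
Proof.
move=> dH; pose b : 'Hom((V1 * V2)%type, K^o) := (alpha H \o linfun (@snd V1 V2))%VF.
have bE u : b u = alpha H u.2 by rewrite comp_lfunE lfunE.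
have nzb : b != 0.
  apply/eqP => /lfunP b0; case/eqP: (alpha_neq0 dH); apply/lfunP => u.
  by have := b0 (0, u); rewrite bE !lfunE.
have kb : lker b = dsum {:V1} H.
  apply/vspaceP => u; rewrite memv_ker bE mem_dsum memvf /=.
  by rewrite -memv_ker lker_alpha.
have [c nzc cE] := alpha_proportional nzb kb.
exists c => //; apply: form_poly_prodr => u.
by rewrite cE bE.
Qed.

Lemma prod_scaled (I : eqType) (r : seq I) n (F G : I -> {mpoly K[n]}) :
  {in r, forall i, exists2 c : K, c != 0 & F i = c *: G i} ->
  exists2 c : K, c != 0 & \prod_(i <- r) F i = c *: \prod_(i <- r) G i.
Proof.
elim: r => [|i r IHr] h.
  by exists 1; rewrite ?oner_neq0 // !big_nil scale1r.
have [|c nzc cE] := IHr; first by move=> j jr; apply: h; rewrite inE jr orbT.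
have [c' nzc' c'E] := h i (mem_head _ _).
exists (c' * c); first by rewrite mulf_neq0.
by rewrite !big_cons cE c'E -scalerAl -scalerAr scalerA.
Qed.

Lemma defpoly_prod (A1 : {fset {vspace V1}}) (A2 : {fset {vspace V2}}) :
  arrangement A1 -> arrangement A2 ->
  exists2 c : K, c != 0 & defpoly v (prod_arr A1 A2) =
    c *: (minj s (defpoly v1 A1) * minj (swap s) (defpoly v2 A2)).
Proof.
move=> hA1 hA2.
have enumE : perm_eq (enum_fset (prod_arr A1 A2))
    ([seq dsum H {:V2} | H <- enum_fset A1] ++ [seq dsum {:V1} H | H <- enum_fset A2]).
  apply: uniq_perm; first exact: fset_uniq.
    rewrite cat_uniq; apply/and3P; split.
    - rewrite map_inj_uniq ?fset_uniq // => H H' /vspaceP e.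
      by apply/vspaceP => u; have := e (u, 0); rewrite !mem_dsum /= !memvf !andbT.
    (* The two families are disjoint: [H1 + V2 = V1 + H2] would force [H1] to be all of [V1]. No
       factor is thus lost in the union. *)
    - apply/hasPn => U /mapP[H2 _ ->]; apply/negP => /mapP[H1 H1A e].
      have /eqP[] := hyperplane_neq (hA1 _ H1A); apply/vspaceP => u.
      have /vspaceP/(_ (u, 0)) := e; rewrite !mem_dsum /= !memvf andbT mem0v.
      by move=> <-.
    rewrite map_inj_uniq ?fset_uniq // => H H' /vspaceP e.
    by apply/vspaceP => u; have := e (0, u); rewrite !mem_dsum /= !memvf.
  move=> U; rewrite mem_cat in_fsetU; congr (_ || _).
    by apply/imfsetP/mapP => -[H HA ->]; exists H.
  by apply/imfsetP/mapP => -[H HA ->]; exists H.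
rewrite /defpoly (perm_big _ enumE) big_cat !big_map /=.
have [c1 nz1 ->] := prod_scaled (fun H HA => alpha_dsuml (hA1 H HA)).
have [c2 nz2 ->] := prod_scaled (fun H HA => alpha_dsumr (hA2 H HA)).
exists (c1 * c2); first by rewrite mulf_neq0.
rewrite (rmorph_prod (minj s)) (rmorph_prod (minj (swap s))) /=.
by rewrite -scalerAl -scalerAr scalerA.
Qed.

End ProductPolynomial.

(** * From operators to coefficient families *)

Section OperatorBases.
Variables (K : fieldType) (V : vectType K) (l : nat) (v : l.-tuple V) (m : nat).
Variable A : {fset {vspace V}}.
Hypothesis charK : [pchar K] =i pred0.
Local Notation S := {mpoly K[l]}.
Local Notation Q := (defpoly v A).

Lemma diffop_hop (f : 'X_{1..l} -> S) :
  diffop m f =1 hop m (fun a => (mfact a)%:R *: f a).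
Proof.
move=> p; apply: eq_bigr => a _; rewrite /hasse -scalerAl -scalerAr scalerA.
by rewrite mulfV ?scale1r // mfact_neq0.
Qed.

Lemma hop_diffop (g : 'X_{1..l} -> S) :
  hop m g =1 diffop m (fun a => (mfact a)%:R^-1 *: g a).
Proof.
by move=> p; apply: eq_bigr => a _; rewrite /hasse -scalerAl -scalerAr.
Qed.

Lemma hop_sum (T : finType) (c : T -> S) (g : T -> 'X_{1..l} -> S) h p :
  (forall a, mdeg a = m -> h a = \sum_t c t * g t a) ->
  hop m h p = \sum_t c t * hop m (g t) p.
Proof.
move=> hE; rewrite /hop; under [RHS]eq_bigr do rewrite mulr_sumr.
rewrite exchange_big /=; apply: eq_bigr => a /eqP da; rewrite hE // mulr_suml.
by apply: eq_bigr => t _; rewrite mulrA.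
Qed.

(** Evaluating an operator of order [m] at monomials of degree [m] recovers its coefficients, so
    identities between operators and between coefficients are equivalent. *)
Lemma is_basisDA_hop N (theta : 'I_N -> S -> S) (g : 'I_N -> 'X_{1..l} -> S) :
  (forall j, theta j =1 hop m (g j)) ->
  is_basisDA v m A theta <-> islogbasis m Q g.
Proof.
move=> tE; have tX j a : mdeg a = m -> theta j 'X_[a] = g j a.
  by move=> da; rewrite tE hopX.
split=> -[D G F]; split.
- move=> j; apply/(logcoefP charK) => p; have [_ /(_ p)[q qE]] := D j.
  by exists q; rewrite -tE.
- move=> h hh; have [|c hc] := G (hop m h).
    split; first by exists (fun a => (mfact a)%:R^-1 *: h a); apply: hop_diffop.
    exact/(logcoefP charK).
  exists c => a da; rewrite -(hopX charK _ da) hc.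
  by apply: eq_bigr => j _; rewrite tX.
- move=> c hc; apply: F => p.
  under eq_bigr do rewrite tE.
  rewrite -(hop_sum (h := fun=> 0)); first by rewrite /hop big1 // => a _; rewrite mul0r.
  by move=> a da; rewrite hc.
- move=> j; split.
    exists (fun a => (mfact a)%:R^-1 *: g j a) => p; rewrite tE.
    exact: hop_diffop.
  move=> p; have [q qE] := (logcoefP charK m Q (g j)).1 (D j) p.
  by exists q; rewrite tE.
- move=> eta [[f fE] hQ].
  have etaE p : eta p = hop m (fun a => (mfact a)%:R *: f a) p.
    by rewrite fE diffop_hop.
  have [|c hc] := G (fun a => (mfact a)%:R *: f a).
    by apply/(logcoefP charK) => p; have [q qE] := hQ p; exists q; rewrite -etaE.
  exists c => p; rewrite etaE (hop_sum _ hc).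
  by apply: eq_bigr => j _; rewrite tE.
move=> c hc; apply: F => a da; rewrite -[RHS](hc 'X_[a]).
by apply: eq_bigr => j _; rewrite tX.
Qed.

Definition homog_logbasis N (dg : 'I_N -> nat) (g : 'I_N -> 'X_{1..l} -> S) :=
  islogbasis m Q g /\ forall j a, mdeg a = m -> g j a \is (dg j).-homog.

Lemma mfreeP : mfree v m A <-> exists N (g : 'I_N -> 'X_{1..l} -> S), islogbasis m Q g.
Proof.
split=> [[N [theta tB]]|[N [g gB]]]; last first.
  by exists N, (fun j => hop m (g j)); apply/(is_basisDA_hop (g := g)).
have [D _ _] := tB; have [f hf] := fin_all_exists (fun j => (D j).1).
exists N, (fun j a => (mfact a)%:R *: f j a).
by apply/(is_basisDA_hop (theta := theta)) => // j p; rewrite hf diffop_hop.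
Qed.

Lemma is_expP (d : seq nat) : (0 < m)%N ->
  is_exp v m A d <->
  exists g, homog_logbasis (fun j : 'I_(size d) => nth 0%N d j) g.
Proof.
move=> m0; rewrite /is_exp -[m == 0%N]negbK -lt0n m0 /=.
split=> [[theta [tB hom]]|[g [gB hom]]].
  have [f hf] := fin_all_exists hom.
  exists (fun j a => (mfact a)%:R *: f j a); split.
    by apply/(is_basisDA_hop (theta := theta)) => // j p; rewrite (hf j).2 diffop_hop.
  by move=> j a da; apply: dhomogZ; apply: (hf j).1.
exists (fun j => hop m (g j)); split; first exact/(is_basisDA_hop (g := g)).
move=> j; exists (fun a => (mfact a)%:R^-1 *: g j a); split; last exact: hop_diffop.
by move=> a da; apply/dhomogZ/hom.
Qed.

Lemma is_exp_homog_logbasis (d : seq nat) : is_exp v m A d ->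
  exists g, homog_logbasis (fun j : 'I_(size d) => nth 0%N d j) g.
Proof.
have [m0|] := posnP m; last by move=> /is_expP ->.
rewrite /is_exp m0 eqxx => ->; exists (fun _ _ => 1); rewrite /homog_logbasis m0.
split; first exact: logbasis_m0.
by move=> j a _; rewrite ord1 /= dhomog1.
Qed.

Lemma homog_logbasis_degrees N N' (dg : 'I_N -> nat) (dg' : 'I_N' -> nat) g g' :
  homog_logbasis dg g -> homog_logbasis dg' g' ->
  perm_eq [seq dg i | i <- enum 'I_N] [seq dg' i | i <- enum 'I_N'].
Proof.
move=> [[D G F] hom] [[D' G' F'] hom'].
have [C hC] := fin_all_exists (fun j => G' _ (D j)).
have [C' hC'] := fin_all_exists (fun j => G _ (D' j)).
have rE k (h : 'I_k -> 'X_{1..l} -> S) t :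
    row t (\matrix_t coefrow m (h t)) = coefrow m (h t) by rewrite rowK.
have freeE k (h : 'I_k -> 'X_{1..l} -> S) :
    (forall c, (forall a, mdeg a = m -> \sum_t c t * h t a = 0) -> forall t, c t = 0) ->
    is_free (\matrix_t coefrow m (h t)).
  move=> fh c; rewrite -(coefrow_sum _ (rE k h)) => c0; apply/rowP => t.
  rewrite mxE; apply: (fh (fun t => c 0 t)) => a.
  have e0 : coefrow m (fun a => \sum_t c 0 t * h t a) = coefrow m (fun=> 0).
    by rewrite c0; apply/rowP => x; rewrite !mxE.
  by move/eq_coefrow: e0; apply.
have changeE k k' (h : 'I_k -> 'X_{1..l} -> S) (h' : 'I_k' -> 'X_{1..l} -> S) B :
    (forall j a, mdeg a = m -> h j a = \sum_t B j t * h' t a) ->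
    \matrix_t coefrow m (h t) = (\matrix_(j, t) B j t) *m \matrix_t coefrow m (h' t).
  move=> hB; apply/row_matrixP => j; rewrite row_mul rE -(coefrow_sum _ (rE _ h')).
  apply/eq_coefrow => a da; rewrite hB //.
  by apply: eq_bigr => t _; rewrite !mxE.
apply: (homog_basis_degrees (freeE _ _ F) (freeE _ _ F') (changeE _ _ _ _ _ hC)
  (changeE _ _ _ _ _ hC')) => i k; rewrite !mxE.
  by apply: hom; apply: mdeg_mindex.
by apply: hom'; apply: mdeg_mindex.
Qed.

End OperatorBases.

(** * Exponents of the product *)

Section Exponents.
Variables (K : fieldType) (p q n : nat) (s : splitting p q n).

Lemma minj_homog d (f : {mpoly K[p]}) : f \is d.-homog -> minj s f \is d.-homog.
Proof.
move=> hf; apply/dhomogP => u; rewrite -(mcatK s u) mcoeff_msupp mcoeff_minj.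
move=> nz; have b0 : mpr s u = 0%MM.
  by apply/eqP; apply: contraNT nz => /negbTE ->; rewrite mulr0.
have : mpl s u \in msupp f.
  by rewrite mcoeff_msupp; apply: contraNneq nz => ->; rewrite mul0r.
move/(dhomogP _ _ _ hf) => /= <-.
by rewrite -[LHS]/(mdeg _) mdeg_cat b0 mdeg0 addn0.
Qed.

End Exponents.

Lemma perm_map_enum_val (T : finType) (deg : T -> nat) :
  perm_eq [seq deg t | t <- enum T] [seq deg (enum_val i) | i <- enum 'I_#|T|].
Proof.
rewrite [X in perm_eq _ X](map_comp deg enum_val).
apply/perm_map/uniq_perm => [||t].
- exact: enum_uniq.
- by rewrite map_inj_uniq ?enum_uniq //; apply: enum_val_inj.
by rewrite mem_enum -(enum_rankK t) map_f // mem_enum.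
Qed.

(** Lets a homogeneous basis indexed by [T] be listed with its degrees in the prescribed order
    [c]. *)
Lemma perm_eq_bij (T : finType) (deg : T -> nat) (c : seq nat) :
  perm_eq c [seq deg t | t <- enum T] ->
  exists2 f : 'I_(size c) -> T,
    bijective f & forall j : 'I_(size c), nth 0%N c j = deg (f j).
Proof.
have tE : perm_eq [seq deg t | t <- enum T] [tuple deg (enum_val i) | i < #|T|].
  exact: perm_map_enum_val.
move=> /perm_trans/(_ tE) h; have := perm_size h; rewrite size_tuple => sz.
have /tuple_permP[w cE] := h.
exists (fun j => enum_val (w (cast_ord sz j))).
  apply: bij_comp (enum_val_bij T) _; apply: bij_comp; first exact: (injF_bij (@perm_inj _ w)).
  by exists (cast_ord (esym sz)) => x; [apply: cast_ordK | apply: cast_ordKV].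
move=> j; have ltj : (j < #|T|)%N by rewrite -sz.
rewrite {1}cE (nth_map (Ordinal ltj)) ?size_enum_ord // tnth_mktuple.
by congr (deg (enum_val (w _))); apply: val_inj; rewrite /= nth_enum_ord.
Qed.

Lemma big_nth_ord (s : seq nat) (F : nat -> nat) :
  \sum_(a <- s) F a = \sum_(j < size s) F (nth 0%N s j).
Proof. by rewrite (big_nth 0%N) big_mkord. Qed.

Definition tens_degree m (d e : nat -> seq nat)
    (t : tens_index (fun i => size (d i)) (fun i => size (e i)) m) : nat :=
  (nth 0 (d (tag t)) (tagged t).1 + nth 0 (e (m - tag t)) (tagged t).2)%N.

(** Multisets agree when every predicate has the same count in both; the counts are the same
    iterated sum over [i], [j] and [k]. *)
Lemma perm_tens_degrees m (d e : nat -> seq nat) :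
  perm_eq
    [seq @tens_degree m d e t
       | t <- enum (tens_index (fun i => size (d i)) (fun i => size (e i)) m)]
    (flatten [seq [seq (a + b)%N | a <- d i, b <- e (m - i)%N] | i <- iota 0 m.+1]).
Proof.
apply/seq.permP => P; rewrite -!sum1_count big_mkcond [RHS]big_mkcond.
rewrite big_map big_enum big_flatten big_map.
rewrite -[iota 0 m.+1]/(index_iota 0 m.+1) big_mkord.
pose F i j k := if P (nth 0 (d i) j + nth 0 (e (m - i)) k)%N then 1%N else 0%N.
transitivity (\sum_(i < m.+1) \sum_(t : 'I_(size (d i)) * 'I_(size (e (m - i)%N)))
   F i t.1 t.2).
  by rewrite sig_big_dep; apply: eq_bigr => -[i t].
apply: eq_bigr => i _; rewrite -(pair_bigA _ (fun (j : 'I_(size (d i)))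
  (k : 'I_(size (e (m - i)%N))) => F i j k)) /=.
rewrite big_allpairs_dep big_nth_ord; apply: eq_bigr => j _.
by rewrite big_nth_ord.
Qed.

Theorem theorem1p2 (K : fieldType) (charK : [pchar K] =i pred0)
    (V1 V2 : vectType K) (l1 l2 : nat)
    (v1 : l1.-tuple V1) (hv1 : basis_of {:V1} v1)
    (v2 : l2.-tuple V2) (hv2 : basis_of {:V2} v2)
    (hl1 : (0 < l1)%N) (hl2 : (0 < l2)%N)
    (A1 : {fset {vspace V1}}) (hA1 : arrangement A1)
    (A2 : {fset {vspace V2}}) (hA2 : arrangement A2)
    (m : nat) (hm : (1 <= m)%N) :
  (mfree (prod_basis v1 v2) m (prod_arr A1 A2) <->
     (forall i : nat, (1 <= i <= m)%N -> mfree v1 i A1 /\ mfree v2 i A2)) /\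
  (mfree (prod_basis v1 v2) m (prod_arr A1 A2) ->
   forall d e : nat -> seq nat,
     (forall i : nat, (i <= m)%N -> is_exp v1 i A1 (d i)) ->
     (forall i : nat, (i <= m)%N -> is_exp v2 (m - i) A2 (e (m - i)%N)) ->
   forall c : seq nat,
     is_exp (prod_basis v1 v2) m (prod_arr A1 A2) c <->
     perm_eq c (flatten [seq [seq (a + b)%N | a <- d i, b <- e (m - i)%N]
                            | i <- iota 0 m.+1])).
Proof.
have nzQ1 := defpoly_neq0 hv1 hA1; have nzQ2 := defpoly_neq0 hv2 hA2.
have [k nzk QE] := defpoly_prod v1 v2 hA1 hA2.
(* The nonzero constant in the defining polynomial of the product changes no logarithmic
   condition. *)
have basisE (T : finType) g : islogbasis m (defpoly (prod_basis v1 v2) (prod_arr A1 A2)) g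
    <-> islogbasis (T := T) m (minj (sum_splitting l1 l2) (defpoly v1 A1) *
        minj (swap (sum_splitting l1 l2)) (defpoly v2 A2)) g.
  by rewrite QE; apply: islogbasisZ.
split.
  split=> [/(mfreeP _ _ _ charK)[N [g /basisE gB]] i /andP[_ lei]|h].
    have [d1 hQ1] := defpoly_homog v1 A1; have [d2 hQ2] := defpoly_homog v2 A2.
    split; apply/(mfreeP _ _ _ charK).
      exact: (islogbasis_factor charK nzQ1 nzQ2 hQ1 hl2 lei gB).
    (* The second factor is the first one of the swapped splitting. *)
    apply: (islogbasis_factor (s := swap (sum_splitting l1 l2)) charK nzQ2 nzQ1
      hQ2 hl1 lei (G := g)).
    by rewrite mulrC.
  (* The hypothesis starts at order 1; order 0 is supplied by [logbasis_m0]. *)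
  have B1 (i : 'I_m.+1) : exists N (g : 'I_N -> _), islogbasis i (defpoly v1 A1) g.
    have [i0|i0] := posnP i; first by rewrite i0; do 2!eexists; apply: logbasis_m0.
    by apply/(mfreeP _ _ _ charK); apply: (h i _).1; rewrite i0 -ltnS ltn_ord.
  have B2 (i : 'I_m.+1) : exists N (g : 'I_N -> _), islogbasis i (defpoly v2 A2) g.
    have [i0|i0] := posnP i; first by rewrite i0; do 2!eexists; apply: logbasis_m0.
    by apply/(mfreeP _ _ _ charK); apply: (h i _).2; rewrite i0 -ltnS ltn_ord.
  have [n1 /fin_all_exists[g1 gB1]] := fin_all_exists B1.
  have [n2 /fin_all_exists[g2 gB2]] := fin_all_exists B2.
  (* [inord] extends the families to all of [nat] without changing them at orders up to [m]. *)
  have B := islogbasis_tens (sum_splitting l1 l2) charK nzQ1 nzQ2 (m := m)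
    (g1 := fun i => g1 (inord i)) (g2 := fun i => g2 (inord i)).
  apply/(mfreeP _ _ _ charK).
  exists #|tens_index (fun i => n1 (inord i)) (fun i => n2 (inord i)) m|.
  eexists; apply/basisE; apply: islogbasis_bij (enum_val_bij _) (B _) => i lei.
  by split; [have := gB1 (inord i) | have := gB2 (inord i)]; rewrite inordK.
move=> _ d e hd he c.
(* Exponents are given only for orders up to [m], so the lists are restricted to ['I_m.+1]; [inord]
   extends them again below. *)
have [D DE] : exists D : 'I_m.+1 -> seq nat, forall i, D i = d i.
  by exists (fun i => d i).
have [E EE] : exists E : 'I_m.+1 -> seq nat, forall i, E i = e i.
  by exists (fun i => e i).
have B1 (i : 'I_m.+1) : exists g, homog_logbasis v1 i A1
    (fun j : 'I_(size (D i)) => nth 0%N (D i) j) g.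
  by rewrite DE; apply: is_exp_homog_logbasis => //; apply: hd; rewrite -ltnS.
have B2 (i : 'I_m.+1) : exists g, homog_logbasis v2 i A2
    (fun j : 'I_(size (E i)) => nth 0%N (E i) j) g.
  rewrite EE; apply: is_exp_homog_logbasis => //.
  (* The assumption on [e] at [m - i] concerns the order [m - (m - i) = i]. *)
  by have := he _ (leq_subr i m); rewrite subKn // -ltnS ltn_ord.
have [g1 gB1] := fin_all_exists B1; have [g2 gB2] := fin_all_exists B2.
pose d' i := D (inord i); pose e' i := E (inord i).
have -> : [seq [seq (a + b)%N | a <- d i, b <- e (m - i)%N] | i <- iota 0 m.+1] =
    [seq [seq (a + b)%N | a <- d' i, b <- e' (m - i)%N] | i <- iota 0 m.+1].
  apply/eq_in_map => i; rewrite mem_iota => /andP[_ lti].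
  by rewrite /d' /e' DE EE !inordK // ltnS leq_subr.
rewrite -(permPr (perm_tens_degrees m d' e')).
pose T := tens_index (fun i => size (d' i)) (fun i => size (e' i)) m.
pose dg : T -> nat := @tens_degree m d' e'.
pose g : T -> _ := tens_basis (sum_splitting l1 l2)
  (n1 := fun i => size (d' i)) (n2 := fun i => size (e' i))
  (fun i => g1 (inord i)) (fun i => g2 (inord i)) (m := m).
have gB : islogbasis m (minj (sum_splitting l1 l2) (defpoly v1 A1) *
    minj (swap (sum_splitting l1 l2)) (defpoly v2 A2)) g.
  apply: islogbasis_tens => // i lei.
  by split; [have := (gB1 (inord i)).1 | have := (gB2 (inord i)).1]; rewrite inordK.
have gH t w : mdeg w = m -> g t w \is (dg t).-homog.
  case: t => i [j k'] dw; rewrite /g /tens_basis /tens /=.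
  case: eqP => [di|_]; last exact: rpred0.
  have lei : (i <= m)%N by rewrite -ltnS.
  have dr : mdeg (mpr (sum_splitting l1 l2) w) = (m - i)%N.
    by have := congr1 mdeg (mcatK (sum_splitting l1 l2) w); rewrite mdeg_cat dw; lia.
  apply: dhomogM; apply: minj_homog.
    by apply: (gB1 (inord i)).2; rewrite inordK.
  by apply: (gB2 (inord (m - i))).2; rewrite inordK // ltnS leq_subr.
have bij_basis N (f : 'I_N -> T) : bijective f ->
    homog_logbasis (prod_basis v1 v2) m (prod_arr A1 A2) (dg \o f) (g \o f).
  move=> bf; split; first by apply/basisE; apply: islogbasis_bij bf gB.
  by move=> j a; apply: gH.
split=> [/(is_expP _ _ charK _ hm)[g' gB']|/perm_eq_bij[f bf hf]].
  (* Any homogeneous basis has the same degrees as the tensor basis. *)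
  have := homog_logbasis_degrees gB' (bij_basis _ _ (enum_val_bij T)).
  rewrite [X in perm_eq X _](_ : _ = c) => [/perm_trans|].
    by apply; rewrite perm_sym; apply: perm_map_enum_val.
  rewrite (map_comp (nth 0%N c) (@nat_of_ord _)) val_enum_ord.
  exact: mkseq_nth.
apply/(is_expP _ _ charK _ hm); exists (g \o f).
have [gB' gH'] := bij_basis _ _ bf; split=> // j a da.
by rewrite hf; apply: gH'.
Qed.
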